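(* Let $M$ be a connected sRC-manifold, complete with respect to its sub-Riemannian distance, let $\mathscr{K}$ be the Lie algebra of its $H$-Killing fields, and let $p\in M$. Then the linear map $$\chi_p:\mathscr{K}\to T_pM\times\mathfrak{skew}(H_pM),\qquad \chi_p(K)=\left(K_{|p},\,(\mathcal{B}_K)_{|p}\right)$$ is injective, where $\mathfrak{skew}(H_pM)$ is the space of skew-adjoint endomorphisms of $H_pM$ and $(\mathcal{B}_K)_{|p}$ denotes the restriction of $\mathcal{B}_K$ to $H_pM$.
   Context: A sub-Riemannian manifold is a smooth manifold $M$ with a smooth bracket-generating subbundle $HM\subseteq TM$ and a smooth inner product $\langle\cdot,\cdot\rangle$ on $HM$. An sRC-manifold is a sub-Riemannian manifold together with a smooth subbundle $VM$ such that $TM=HM\oplus VM$. Subscripts $H$, $V$ denote the projections onto $HM$, $VM$. A smooth vector field $K$ is an $H$-Killing field if $[K,HM]\subset HM$, $[K,VM]\subset VM$ (brackets with sections), and $K\langle X,Y\rangle=\langle[K,X],Y\rangle+\langle X,[K,Y]\rangle$ for all sections $X,Y$ of $HM$. Fix a Riemannian metric $g$ extending $\langle\cdot,\cdot\rangle$ with $HM\perp VM$ (a metric extension). The canonical connection $\nabla$ is the unique connection that is compatible with $g$, makes $HM$ and $VM$ parallel, and whose torsion $\mathrm{Tor}(A,B)=\nabla_AB-\nabla_BA-[A,B]$ satisfies $\mathrm{Tor}(HM,HM)\subseteq VM$, $\mathrm{Tor}(VM,VM)\subseteq HM$, and $g(\mathrm{Tor}(Z,X),Y)=g(\mathrm{Tor}(Z,Y),X)$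 whenever $X,Y$ lie in one of $HM,VM$ and $Z$ lies in the other. For $X$ horizontal, $\nabla X$ does not depend on $g$. For an $H$-Killing field $K$, $\mathcal{B}_K:TM\to HM$ is the (tensorial) operator $$\mathcal{B}_K(A)=\nabla_AK_H+\mathrm{Tor}(K,A)_H=(\nabla_KA-[K,A])_H.$$ It is skew-adjoint on $HM$. *)

(* Defs.v *)
From HB Require Import structures.
From mathcomp Require Import all_boot all_order all_algebra.
From mathcomp Require Import all_classical all_reals all_analysis.

Set Implicit Arguments.
Unset Strict Implicit.
Unset Printing Implicit Defensive.

Import Order.TTheory GRing.Theory Num.Theory.
Import numFieldNormedType.Exports.

Local Open Scope classical_set_scope.
Local Open Scope ring_scope.

(** * Smooth manifolds *)

(* Partial derivatives up to order [k] exist and are continuous on the set [U],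
   which is meant to be open: all values outside [U] are irrelevant. *)
Fixpoint Ck (R : realType) (n k : nat) (U : set 'rV[R]_n)
    (f : 'rV[R]_n -> R) : Prop :=
  (forall x, U x -> {for x, continuous f}) /\
  (if k is k'.+1 then
     forall i : 'I_n, (forall x, U x -> derivable f x (delta_mx 0 i)) /\
                      Ck k' U ('D_(delta_mx 0 i) f)
   else True).

Definition Cinf (R : realType) (n : nat) (U : set 'rV[R]_n)
  (f : 'rV[R]_n -> R) : Prop := forall k, Ck k U f.

(* [cmap] and [cinv] are total functions; only their values on [cdom] and
   [cmap @` cdom] are meaningful. *)
Record chart (R : realType) (n : nat) (M : topologicalType) := Chart {
  cdom : set M;
  cmap : M -> 'rV[R]_n;
  cinv : 'rV[R]_n -> M;
  cdom_open : open cdom;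
  cimg_open : open (cmap @` cdom);
  cmap_continuous : forall x, cdom x -> {for x, continuous cmap};
  cinv_continuous : forall y, (cmap @` cdom) y -> {for y, continuous cinv};
  cmapK : forall x, cdom x -> cinv (cmap x) = x }.

Record manifold (R : realType) (n : nat) := Manifold {
  mcarrier :> topologicalType;
  manifold_hausdorff : hausdorff_space mcarrier;
  manifold_second_countable : @second_countable mcarrier;
  atlas : set (chart R n mcarrier);
  atlas_cover : forall x : mcarrier, exists2 c, atlas c & cdom c x;
  atlas_compatible : forall c c', atlas c -> atlas c' -> forall j,
    Cinf (cmap c @` (cdom c `&` cdom c'))
         (fun x => cmap c' (cinv c x) 0 j) }.

Section VectorFields.
Context (R : realType) (n : nat) (M : manifold R n).

Definition smooth_on (W : set M) (f : M -> R) : Prop :=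
  forall c, atlas c -> Cinf (cmap c @` (cdom c `&` W)) (f \o cinv c).

Definition smooth (f : M -> R) : Prop := smooth_on setT f.

(* A tangent vector is identified with the directional derivative it defines
   on smooth functions, extended by 0 to all functions so that two tangent
   vectors acting equally on smooth functions are equal. Thus [T_p M] is a
   subset of the vector space [tvec], and vector fields are elements of the
   vector space [vfield]. *)
Definition tvec : Type := (M -> R) -> R.
Definition vfield : Type := M -> tvec.

HB.instance Definition _ := GRing.Lmodule.on tvec.
HB.instance Definition _ := GRing.Lmodule.on vfield.

Definition tangent (p : M) : set tvec :=
  [set v | exists c (a : 'rV[R]_n), [/\ atlas c, cdom c p &
     forall f, v f = if `[< smooth f >] then 'D_a (f \o cinv c) (cmap c p)
                     else 0 ]].

Definition smooth_vf_on (W : set M) (X : vfield) : Prop :=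
  (forall p, W p -> tangent p (X p)) /\
  (forall f, smooth f -> smooth_on W (fun p => X p f)).

Definition smooth_vf (X : vfield) : Prop := smooth_vf_on setT X.

(* Product of a vector field by a function. *)
Definition fscale (f : M -> R) (X : vfield) : vfield := fun p => f p *: X p.

(* Derivative of a function along a vector field. *)
Definition vf_app (X : vfield) (f : M -> R) : M -> R := fun p => X p f.

Definition lie (X Y : vfield) : vfield :=
  fun p f => X p (vf_app Y f) - Y p (vf_app X f).

Record subbundle := Subbundle {
  fiber :> M -> set tvec;
  rank : nat;
  fiber_tangent : forall p, fiber p `<=` tangent p;
  local_frame : forall p, exists W : set M, exists X : 'I_rank -> vfield,
    [/\ open W /\ W p, forall i, smooth_vf_on W (X i),
        forall q v, W q ->
          fiber q v <-> exists a : 'rV[R]_rank, v = \sum_i a 0 i *: X i q &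
        forall q (a : 'rV[R]_rank), W q ->
          \sum_i a 0 i *: X i q = 0 -> a = 0] }.

Definition is_section (E : M -> set tvec) (X : vfield) : Prop :=
  smooth_vf X /\ forall p, E p (X p).

(* The Lie algebra generated by a set of vector fields. *)
Inductive lie_hull (S : set vfield) : set vfield :=
| lie_hull_gen X : S X -> lie_hull S X
| lie_hull_lin (a : R) X Y :
    lie_hull S X -> lie_hull S Y -> lie_hull S (a *: X + Y)
| lie_hull_lie X Y : lie_hull S X -> lie_hull S Y -> lie_hull S (lie X Y).

Definition bracket_generating (E : M -> set tvec) : Prop :=
  forall p v, tangent p v -> exists2 X, lie_hull (is_section E) X & X p = v.

(* [b p] is only meaningful on [E p]. *)
Definition vf_inner (b : M -> tvec -> tvec -> R) (X Y : vfield) : M -> R :=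
  fun p => b p (X p) (Y p).

Record is_smooth_inner (E : M -> set tvec) (b : M -> tvec -> tvec -> R) :
    Prop := IsSmoothInner {
  inner_sym : forall p u v, E p u -> E p v -> b p u v = b p v u;
  inner_linear : forall p (a : R) u v w, E p u -> E p v -> E p w ->
    b p (a *: u + v) w = a * b p u w + b p v w;
  inner_pos : forall p v, E p v -> v != 0 -> 0 < b p v v;
  inner_smooth : forall X Y, is_section E X -> is_section E Y ->
    smooth (vf_inner b X Y) }.

End VectorFields.

(** * Sub-Riemannian and sRC-manifolds *)

Record sub_riemannian (R : realType) (n : nat) (M : manifold R n) :=
  SubRiemannian {
    HM : subbundle M;
    HM_bracket_generating : bracket_generating HM;
    hinner : M -> tvec M -> tvec M -> R;
    hinnerP : is_smooth_inner HM hinner }.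

Record sRC (R : realType) (n : nat) (M : manifold R n) := SRC {
  sRC_sub_riemannian :> sub_riemannian M;
  VM : subbundle M;
  HM_VM_direct : forall p v, tangent p v ->
    exists! h, HM sRC_sub_riemannian p h /\ VM p (v - h) }.

Section SubRiemannianDistance.
Context (R : realType) (n : nat) (M : manifold R n) (S : sub_riemannian M).

Definition velocity (c : R -> M) (t : R) : tvec M :=
  fun f => if `[< smooth f >] then derive1 (f \o c) t else 0.

Definition smooth_curve (c : R -> M) : Prop :=
  continuous c /\
  forall f, smooth f -> forall k t, derivable (derive1n k (f \o c)) t 1.

(* A smooth curve on the closed interval [0, 1] is the restriction of a smooth
   curve on the line; horizontality is only required on [0, 1]. *)
Definition horizontal_curve (c : R -> M) : Prop :=
  smooth_curve c /\ forall t, 0 <= t <= 1 -> HM S (c t) (velocity c t).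

Definition curve_length (c : R -> M) : R :=
  \int[lebesgue_measure]_(t in `[0, 1])
    Num.sqrt (hinner S (c t) (velocity c t) (velocity c t)).

(* [joined p q l]: some piecewise smooth horizontal curve from [p] to [q] has
   length [l]. *)
Inductive joined (p : M) : M -> R -> Prop :=
| joined_refl : joined p p 0
| joined_step c l : joined p (c 0) l -> horizontal_curve c ->
    joined p (c 1) (l + curve_length c).

Definition sr_dist (p q : M) : \bar R :=
  ereal_inf [set l%:E | l in joined p q].

Definition sr_complete : Prop := forall u : nat -> M,
  (forall e : R, 0 < e -> exists N, forall i j,
     (N <= i)%N -> (N <= j)%N -> (sr_dist (u i) (u j) < e%:E)%E) ->
  exists x, forall e : R, 0 < e -> exists N, forall i,
     (N <= i)%N -> (sr_dist (u i) x < e%:E)%E.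

End SubRiemannianDistance.

Section HKilling.
Context (R : realType) (n : nat) (M : manifold R n) (S : sRC M).

Definition hproj (X : vfield M) : vfield M :=
  fun p => xget 0 [set h | HM S p h /\ VM S p (X p - h)].

Definition H_Killing : set (vfield M) := [set K |
  [/\ smooth_vf K,
      forall X, is_section (HM S) X -> is_section (HM S) (lie K X),
      forall X, is_section (VM S) X -> is_section (VM S) (lie K X) &
      forall X Y, is_section (HM S) X -> is_section (HM S) Y ->
        vf_app K (vf_inner (hinner S) X Y) =
        vf_inner (hinner S) (lie K X) Y + vf_inner (hinner S) X (lie K Y) ]].

Record metric_extension (g : M -> tvec M -> tvec M -> R) : Prop :=
  MetricExtension {
    ext_inner : is_smooth_inner (@tangent R n M) g;
    ext_hinner : forall p u v, HM S p u -> HM S p v -> g p u v = hinner S p u v;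
    ext_orthogonal : forall p h v, HM S p h -> VM S p v -> g p h v = 0 }.

(* Only the values on smooth vector fields are meaningful. *)
Record is_connection (nabla : vfield M -> vfield M -> vfield M) : Prop :=
  IsConnection {
    conn_smooth : forall X Y,
      smooth_vf X -> smooth_vf Y -> smooth_vf (nabla X Y);
    conn_linearl : forall f X X' Y,
      smooth f -> smooth_vf X -> smooth_vf X' -> smooth_vf Y ->
      nabla (fscale f X + X') Y = fscale f (nabla X Y) + nabla X' Y;
    conn_additiver : forall X Y Y',
      smooth_vf X -> smooth_vf Y -> smooth_vf Y' ->
      nabla X (Y + Y') = nabla X Y + nabla X Y';
    conn_leibniz : forall f X Y, smooth f -> smooth_vf X -> smooth_vf Y ->
      nabla X (fscale f Y) = fscale f (nabla X Y) + fscale (vf_app X f) Y }.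

Definition torsion (nabla : vfield M -> vfield M -> vfield M)
  (A B : vfield M) : vfield M := nabla A B - nabla B A - lie A B.

Record canonical_connection (g : M -> tvec M -> tvec M -> R)
    (nabla : vfield M -> vfield M -> vfield M) : Prop :=
  CanonicalConnection {
    canon_connection : is_connection nabla;
    canon_metric : forall Z X Y, smooth_vf Z -> smooth_vf X -> smooth_vf Y ->
      vf_app Z (vf_inner g X Y) =
      vf_inner g (nabla Z X) Y + vf_inner g X (nabla Z Y);
    canon_HM_parallel : forall A X, smooth_vf A -> is_section (HM S) X ->
      is_section (HM S) (nabla A X);
    canon_VM_parallel : forall A X, smooth_vf A -> is_section (VM S) X ->
      is_section (VM S) (nabla A X);
    canon_torHH : forall X Y, is_section (HM S) X -> is_section (HM S) Y ->
      forall p, VM S p (torsion nabla X Y p);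
    canon_torVV : forall X Y, is_section (VM S) X -> is_section (VM S) Y ->
      forall p, HM S p (torsion nabla X Y p);
    canon_torVH : forall Z X Y, is_section (VM S) Z ->
      is_section (HM S) X -> is_section (HM S) Y ->
      vf_inner g (torsion nabla Z X) Y = vf_inner g (torsion nabla Z Y) X;
    canon_torHV : forall Z X Y, is_section (HM S) Z ->
      is_section (VM S) X -> is_section (VM S) Y ->
      vf_inner g (torsion nabla Z X) Y = vf_inner g (torsion nabla Z Y) X }.

Definition BK (nabla : vfield M -> vfield M -> vfield M)
  (K A : vfield M) : vfield M :=
  nabla A (hproj K) + hproj (torsion nabla K A).

(* Some smooth vector field with value [v] at [p]. *)
Definition extend (p : M) (v : tvec M) : vfield M :=
  xget 0 [set A | smooth_vf A /\ A p = v].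

(* The endomorphism of [H_p M] induced by the tensor [BK nabla K], extended
   by 0 outside [H_p M]. *)
Definition BK_at (nabla : vfield M -> vfield M -> vfield M) (K : vfield M)
  (p : M) : tvec M -> tvec M :=
  fun v => if `[< HM S p v >] then BK nabla K (extend p v) p else 0.

(* Skew-adjoint endomorphisms of [H_p M], as functions vanishing outside
   [H_p M]. *)
Definition skew_end (p : M) : set (tvec M -> tvec M) := [set phi |
  [/\ forall v, ~ HM S p v -> phi v = 0,
      forall v, HM S p v -> HM S p (phi v),
      forall (a : R) u v, HM S p u -> HM S p v ->
        phi (a *: u + v) = a *: phi u + phi v &
      forall u v, HM S p u -> HM S p v ->
        hinner S p (phi u) v = - hinner S p u (phi v) ]].

Definition chi (nabla : vfield M -> vfield M -> vfield M) (p : M)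
  (K : vfield M) : tvec M * (tvec M -> tvec M) :=
  (K p, BK_at nabla K p).

End HKilling.

(* Main.v *)
(* By linearity it suffices to show that an H-Killing field [K] with [K p = 0] and
   [B_K = 0] on [H_p M] vanishes. Let [I] be the ideal of germs generated by the
   functions [K f] and [(B_K Y) f] with [Y] horizontal. Since the flow of [K]
   preserves the connection on horizontal fields, [nabla_X B_K = R(X, K)] for [X]
   horizontal; together with [[K, X] = nabla_K X - B_K X] this gives [X I <= I]
   for [X] horizontal. The fields preserving [I] are stable under brackets, so that
   by the bracket-generating condition [I], which is finitely generated, is
   preserved by all partial derivatives. By Gronwall's inequality, the set where
   all elements of [I] vanish is open; it is also closed, and contains [p]. *)
Require Import Defs.
From HB Require Import structures.
From mathcomp Require Import all_boot all_order all_algebra.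
From mathcomp Require Import all_classical all_reals all_analysis.
From mathcomp Require Import ring lra.

Set Implicit Arguments.
Unset Strict Implicit.
Unset Printing Implicit Defensive.

Import Order.TTheory GRing.Theory Num.Theory.
Import numFieldNormedType.Exports.

Local Open Scope classical_set_scope.
Local Open Scope ring_scope.

(** * Calculus on R^n *)

(** The classical argument transports the pair [(K, B_K)] along curves. Here its derivatives are
    controlled in horizontal directions only, and explicit formulas for the remaining directions
    would involve iterated brackets of unbounded depth. An ideal avoids such formulas: being
    preserved by a derivation is a qualitative property that passes to commutators. Finite
    generation then turns it into the linear inequality [|ds| <= C * \sum |s|], which is all that
    Gronwall requires. Testing [K] against functions treats its horizontal and vertical parts
    together. No flow is constructed. Invariance of the connection is proved infinitesimally: the
    Lie derivative of [nabla] along [K] yields a trilinear expression that is symmetric in two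
    arguments and skew in two, hence zero. Germs appear because vector fields act on globally smooth
    functions: coordinates and frames have to be extended by bump functions, and their identities
    survive only near a point. *)

Section PartialDerivatives.
Context {R : realType}.

Lemma is_derive_line n (f : 'rV[R]_n -> R) (x v : 'rV[R]_n) (t : R) :
  derivable f (x + t *: v) v ->
  is_derive t 1 (fun s : R => f (x + s *: v)) ('D_v f (x + t *: v)).
Proof.
move=> df.
have E : (fun h : R => h^-1 *: (((fun s : R => f (x + s *: v)) \o shift t) (h *: 1)
   - f (x + t *: v))) =
  (fun h : R => h^-1 *: ((f \o shift (x + t *: v)) (h *: v) - f (x + t *: v))).
  apply/funext => h /=; congr (_ *: (f _ - _)).
  by rewrite scaler1 scalerDl addrCA.
by apply: DeriveDef; rewrite /derivable /derive E.
Qed.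

Lemma MVT_line n (f : 'rV[R]_n -> R) (x v : 'rV[R]_n) :
  (forall t : R, 0 <= t <= 1 -> derivable f (x + t *: v) v) ->
  exists2 t : R, 0 <= t <= 1 & f (x + v) - f x = 'D_v f (x + t *: v).
Proof.
move=> df; have := @MVT_segment R (fun s : R => f (x + s *: v))
  (fun s => 'D_v f (x + s *: v)) 0 1 ler01.
case.
- move=> t /[!in_itv]/= /andP[t0 t1]; apply: is_derive_line.
  by apply: df; rewrite !ltW.
- apply: derivable_within_continuous => t /[!in_itv]/= tI.
  by have [] := is_derive_line (df t tI).
- move=> c /[!in_itv]/= cI; rewrite scale1r scale0r addr0 subr0 mulr1 => E.
  by exists c.
Qed.

Lemma is_deriveZv n (f : 'rV[R]_n -> R) (x v : 'rV[R]_n) (s : R) :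
  derivable f x v -> is_derive x (s *: v) f (s * 'D_v f x).
Proof.
move=> df.
have H : derivable f (x + (0 : R) *: v) v by rewrite scale0r addr0.
have [D1 D2] := is_derive_line H.
have [sv|s0] := eqVneq s 0.
  rewrite sv scale0r mul0r; exact: is_derive0.
have E : (fun h : R => h^-1 *: ((f \o shift x) (h *: (s *: v)) - f x)) =
  (fun h : R => s * ((s * h)^-1 *: ((f \o shift x) ((s * h) *: v) - f x))).
  apply/funext => h /=; rewrite scalerA (mulrC h s) /GRing.scale /= invfM mulrA mulrA.
  by rewrite divff// mul1r.
have C : (fun h : R => s * ((s * h)^-1 *: ((f \o shift x) ((s * h) *: v) - f x)))
   @ 0^' --> s * 'D_v f x.
  apply: cvgMl_tmp.
  apply: (cvg_comp (fun h : R => s * h)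
    (fun h : R => h^-1 *: ((f \o shift x) (h *: v) - f x))); last first.
    exact: df.
  move=> A /= [e e0 eA]; exists (e / `|s|); rewrite /= ?divr_gt0 ?normr_gt0//.
  move=> y /=; rewrite sub0r normrN ltr_pdivlMr ?normr_gt0// => ys y0.
  apply: eA; rewrite /= ?mulf_neq0// sub0r normrN normrM mulrC//.
apply: DeriveDef.
  by apply/cvg_ex; exists (s * 'D_v f x); rewrite E.
by rewrite /derive E; apply/cvg_lim.
Qed.

(** The bound is the little-o condition with zero differential; at [y = x] it also forces
    [r x = 0]. *)
Lemma diff_flat n (r : 'rV[R]_n -> R) (x : 'rV[R]_n) :
  (forall e : R, 0 < e -> \forall y \near x, `|r y| <= e * `|y - x|) ->
  differentiable r x.
Proof.
move=> H.
have rx : r x = 0.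
  have /nbhs_singleton := H 1 ltr01.
  by rewrite subrr normr0 mulr0 normr_le0 => /eqP.
have o : r \o shift x = cst (r x) + (\0 : {linear 'rV[R]_n -> R}) +o_ (0 : 'rV[R]_n) id.
  apply/eqaddoP => e e0; have := H e e0; rewrite (near_shift 0).
  apply: filterS => y; rewrite /= subr0 => ry.
  set w := (X in `|X| <= _); have -> // : w = r (y + x).
    by rewrite /w -[LHS]/(r (y + x) - (r x + 0)) addr0 rx subr0.
  by move: ry; rewrite addrK.
have c0 : continuous (\0 : {linear 'rV[R]_n -> R}) by apply: cst_continuous.
apply/diff_locallyP; rewrite (diff_unique c0 o); split => //.
Qed.

Lemma rV_norm_le n (x : 'rV[R]_n) (a : R) :
  0 <= a -> (forall i, `|x 0 i| <= a) -> `|x| <= a.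
Proof.
move=> a0 xa; rewrite [leLHS]/Num.Def.normr /= mx_normrE.
by apply: bigmax_le => // -[i j] _ /=; rewrite ord1.
Qed.

Lemma rV_coord_le n (x : 'rV[R]_n) i : `|x 0 i| <= `|x|.
Proof.
by rewrite [leRHS]/Num.Def.normr /= mx_normrE; apply/bigmax_geP; right => /=; exists (0, i).
Qed.

(** Walk from [x] to [y] one coordinate at a time: by the mean value theorem each step contributes
    [h 0 k] times a value of the k-th partial derivative near [x], which continuity compares with
    its value at [x]. *)
Lemma C1_differentiable n (f : 'rV[R]_n -> R) (x : 'rV[R]_n) :
  (\forall y \near x, forall i, derivable f y 'e_i) ->
  (forall i, {for x, continuous ('D_'e_i f)}) -> differentiable f x.
Proof.
move=> df cf; pose c i := 'D_'e_i f x.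
pose L (y : 'rV[R]_n) := f x + \sum_i c i * (y 0 i - x 0 i).
have dL : differentiable L x.
  rewrite (_ : L = cst (f x) +
    \sum_i (fun y : 'rV[R]_n => c i * (y 0 i - x 0 i))); last first.
    by apply/funext => y; rewrite /L -[RHS]/(_ y + _ y) fct_sumE.
  apply: differentiableD => //; apply: differentiable_sum => i.
  rewrite (_ : (fun _ => _) = c i *: ((fun y : 'rV[R]_n => y 0 i) - cst (x 0 i)));
    last by apply/funext.
  apply: differentiableZ; apply: differentiableB => //.
  exact: differentiable_coord.
suff dr : differentiable (f - L) x.
  rewrite (_ : f = (f - L) + L); last by rewrite subrK.
  exact: differentiableD.
apply: diff_flat => e e0.
(* One share for each of the [n] coordinate steps; the successor keeps the denominator nonzero when
   [n = 0]. *)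
pose e' := e / n.+1%:R.
have e'0 : 0 < e' by rewrite divr_gt0.
have : \forall z \near x, (forall i, derivable f z 'e_i) /\
    (forall i, `|c i - 'D_'e_i f z| <= e').
  apply: filterI => //.
  have := @filter_forall _ 'I_n (fun i z => `|c i - 'D_'e_i f z| <= e') (nbhs x) _.
  apply => i.
  by have /cvgrPdist_le/(_ _ e'0) := cf i.
move=> /nbhs_ballP[d /= d0 dP]; apply/nbhs_ballP; exists d => //= y.
rewrite -ball_normE /ball_ /= distrC; set h := y - x => hd.
have hE : y - x = h by [].
clearbody h.
(* [x + tr k] has the first [k] coordinates of [y] and the remaining ones of [x]. *)
pose tr k : 'rV[R]_n := \row_j (if (j < k)%N then h 0 j else 0).
have trN : x + tr n = y.
  have -> : tr n = h by apply/rowP => j; rewrite mxE ltn_ord.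
  by rewrite -hE addrC subrK.
have tr0 : tr 0%N = 0 by apply/rowP => j; rewrite !mxE.
have trS (k : 'I_n) : tr k.+1 = tr k + h 0 k *: 'e_k.
  apply/rowP => j; rewrite !mxE eqxx /= ltnS leq_eqVlt eq_sym -val_eqE /= [k == j :> nat]eq_sym.
  case: eqP => [jk|_] /=; last by rewrite mulr0 addr0.
  have -> : j = k by apply/val_inj.
  by rewrite ltnn add0r mulr1.
have step (k : 'I_n) : `|f (x + tr k.+1) - f (x + tr k) - c k * h 0 k| <= e' * `|h|.
  (* The norm is the maximum norm, so a partial move is no longer than [h]. *)
  have near_seg (t : R) : 0 <= t <= 1 -> ball x d (x + tr k + t *: (h 0 k *: 'e_k)).
    move=> /andP[t0 t1]; rewrite -ball_normE /ball_ /= opprD addrA.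
    rewrite opprD addrA subrr sub0r -opprD normrN.
    apply: le_lt_trans hd; apply: rV_norm_le => // j; rewrite !mxE eqxx /=.
    case: ltnP => jk.
      rewrite -val_eqE /= ltn_eqF//= !mulr0 addr0; exact: rV_coord_le.
    rewrite add0r; case: eqP => _; last by rewrite !mulr0 normr0.
    rewrite mulr1 normrM (ger0_norm t0).
    by apply: le_trans (rV_coord_le _ k); rewrite ler_piMl.
  have [t t01] := @MVT_line n f (x + tr k) (h 0 k *: 'e_k) (fun t t01 =>
    @ex_derive _ _ _ _ _ _ _ (is_deriveZv (h 0 k) ((dP _ (near_seg t t01)).1 k))).
  rewrite -addrA -trS => ->.
  rewrite (@derive_val _ _ _ _ _ _ _ (is_deriveZv (h 0 k) ((dP _ (near_seg t t01)).1 k))).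
  rewrite [c k * _]mulrC -mulrBr normrM mulrC distrC ler_pM//.
    exact: (dP _ (near_seg t t01)).2.
  exact: rV_coord_le.
have -> : (f - L) y = \sum_(k < n) (f (x + tr k.+1) - f (x + tr k) - c k * h 0 k).
  rewrite sumrB -(big_mkord xpredT (fun k => f (x + tr k.+1) - f (x + tr k))).
  rewrite (telescope_sumr (fun k => f (x + tr k)))// trN tr0 addr0.
  rewrite -[LHS]/(f y - L y) /L opprD addrA; congr (_ - _).
  by apply: eq_bigr => i _; rewrite -hE !mxE.
apply: le_trans (ler_norm_sum _ _ _) _.
apply: le_trans (ler_sum _ (fun k _ => step k)) _.
rewrite sumr_const card_ord -mulr_natr /e'.
have -> : e / n.+1%:R * `|h| * n%:R = e * `|h| * (n%:R / n.+1%:R) by ring.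
apply: ler_piMr; first by rewrite mulr_ge0// ltW.
by rewrite ler_pdivrMr// mul1r ler_nat.
Qed.

Lemma derive_sum_coord n (f : 'rV[R]_n -> R) (x v : 'rV[R]_n) :
  differentiable f x -> 'D_v f x = \sum_i v 0 i * 'D_'e_i f x.
Proof.
move=> df; rewrite deriveE// [in LHS](row_sum_delta v) linear_sum.
by apply: eq_bigr => i _; rewrite linearZ /= deriveE.
Qed.

Lemma continuous_near_eq n (U : set 'rV[R]_n) (f g : 'rV[R]_n -> R) x :
  open U -> U x -> (forall x, U x -> f x = g x) ->
  {for x, continuous f} -> {for x, continuous g}.
Proof.
move=> oU Ux fg; have gf : {near x, f =1 g}.
  by near=> y; apply: fg; near: y; exact: open_nbhs_nbhs.
rewrite /prop_for /continuous_at -(fg _ Ux) => cf.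
by apply: cvg_trans cf; exact: (@near_eq_cvg _ _ (nbhs x) _ _ _ gf).
Unshelve. all: by end_near. Qed.

Lemma Ck_eq n k (U : set 'rV[R]_n) (f g : 'rV[R]_n -> R) : open U ->
  (forall x, U x -> f x = g x) -> Ck k U f -> Ck k U g.
Proof.
move=> oU; elim: k f g => [|k IH] f g fg [cf Df].
  by split=> // x Ux; exact: (continuous_near_eq oU Ux fg (cf _ Ux)).
split=> [x Ux|i]; first exact: (continuous_near_eq oU Ux fg (cf _ Ux)).
have [df Cf] := Df i.
have nfg x (Ux : U x) : {near x, f =1 g}.
  by near=> y; apply: fg; near: y; exact: open_nbhs_nbhs.
split.
  by move=> x Ux; apply: near_eq_derivable (nfg _ Ux) (df _ Ux).
apply: IH Cf => x Ux; apply: near_eq_derive; exact: nfg.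
Unshelve. all: by end_near. Qed.

Lemma Ck_sub n k (U V : set 'rV[R]_n) (f : 'rV[R]_n -> R) :
  V `<=` U -> Ck k U f -> Ck k V f.
Proof.
move=> VU; elim: k f => [|k IH] f [cf Df].
  by split=> // x /VU/cf.
split=> [x /VU/cf//|i].
by have [df Cf] := Df i; split; [move=> x /VU/df|exact: IH].
Qed.

(** Every clause of [Ck] is a condition at one point on a total function, so it can be checked on
    any set through that point. *)
Lemma Ck_local n k (U : set 'rV[R]_n) (f : 'rV[R]_n -> R) :
  (forall x, U x -> exists2 V : set 'rV[R]_n, V x & Ck k V f) -> Ck k U f.
Proof.
elim: k f => [|k IH] f H.
  by split=> // x /H[V Vx [cf _]]; exact: cf.
split.
- by move=> x /H [V Vx [cf _]]; exact: cf.
- move=> i; split; first by move=> x /H [V Vx [_ Df]]; have [df _] := Df i; exact: df.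
  by apply: IH => x /H [V Vx [_ Df]]; have [_ Cf] := Df i; exists V.
Qed.

Lemma Cinf_D n (U : set 'rV[R]_n) (f : 'rV[R]_n -> R) i :
  Cinf U f -> Cinf U ('D_'e_i f).
Proof. by move=> Cf k; have [_ /(_ i)[]] := Cf k.+1. Qed.

Lemma Cinf_eq n (U : set 'rV[R]_n) (f g : 'rV[R]_n -> R) : open U ->
  (forall x, U x -> f x = g x) -> Cinf U f -> Cinf U g.
Proof. by move=> oU fg Cf k; apply: Ck_eq fg (Cf k). Qed.

Lemma Cinf_sub n (U V : set 'rV[R]_n) (f : 'rV[R]_n -> R) :
  V `<=` U -> Cinf U f -> Cinf V f.
Proof. by move=> VU Cf k; apply: Ck_sub VU (Cf k). Qed.

Lemma Cinf_local n (U : set 'rV[R]_n) (f : 'rV[R]_n -> R) :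
  (forall x, U x -> exists2 V : set 'rV[R]_n, V x & Cinf V f) -> Cinf U f.
Proof.
by move=> H k; apply: Ck_local => x /H[V Vx Cf]; exists V => //; exact: Cf.
Qed.

Lemma Cinf_differentiable n (U : set 'rV[R]_n) (f : 'rV[R]_n -> R) x :
  open U -> Cinf U f -> U x -> differentiable f x.
Proof.
move=> oU Cf Ux; apply: C1_differentiable.
  near=> y => i; have [_ /(_ i)[df _]] := Cf 1%N; apply: df.
  by near: y; exact: open_nbhs_nbhs.
by move=> i; have [df _] := Cinf_D i Cf 0%N; exact: df.
Unshelve. all: by end_near. Qed.

(** Smoothness by coinduction: membership in [P] provides one derivative at a time, and the partial
    derivatives have to be matched in [P] only up to equality on the open set [U]. *)
Lemma Cinf_coind n (U : set 'rV[R]_n) (P : ('rV[R]_n -> R) -> Prop) : open U ->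
  (forall f, P f -> (forall x, U x -> differentiable f x) /\
     forall i, exists2 g, P g & forall x, U x -> 'D_'e_i f x = g x) ->
  forall f, P f -> Cinf U f.
Proof.
move=> oU HP f Pf k; elim: k f Pf => [|k IH] f /HP[df Df].
  by split=> // x /df; exact: differentiable_continuous.
split.
- by move=> x /df; exact: differentiable_continuous.
- move=> i; split; first by move=> x /df; exact: diff_derivable.
  have [g Pg gE] := Df i; apply: (Ck_eq (f := g)) => //; last exact: IH.
  by move=> x Ux; rewrite gE.
Qed.

(* Bump functions are built from [flat 0]; the other ones make the family stable
   under derivation. *)
Definition flat (m : nat) (x : R) : R :=
  if 0 < x then x^-1 ^+ m * expR (- x^-1) else 0.

Lemma flat_ge0 m (x : R) : 0 <= flat m x.
Proof.
rewrite /flat; case: ifP => // x0.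
by rewrite mulr_ge0 ?expR_ge0// exprn_ge0// invr_ge0 ltW.
Qed.

(** With [y = 1/x], the exponential series gives [y ^ (m+2) / (m+2)! <= exp y]. The bound serves at
    0, where the difference quotient of [flat m] is [flat m.+1] on the right and 0 on the left. *)
Lemma flat_lin m (x : R) : `|flat m.+1 x| <= (m.+2)`!%:R * `|x|.
Proof.
rewrite ger0_norm ?flat_ge0// /flat; case: ifPn => [x0|_]; last by rewrite mulr_ge0.
rewrite (gtr0_norm x0) expRN.
have y0 : 0 < x^-1 by rewrite invr_gt0.
have : x^-1 ^+ m.+2 / (m.+2)`!%:R <= expR x^-1.
  apply: le_trans (expR_ge1Dxn m.+1 (ltW y0)); rewrite lerDr//.
rewrite ler_pdivrMr ?ltr0n ?fact_gt0// => H.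
have -> : x^-1 ^+ m.+1 = x * x^-1 ^+ m.+2 by rewrite [in RHS]exprS mulVKf ?gt_eqF.
by rewrite ler_pdivrMr ?expR_gt0// [_ * x]mulrC -mulrA ler_pM2l// mulrC.
Qed.

Lemma is_derive_flat m (x : R) :
  is_derive x 1 (flat m) (flat m.+2 x - m%:R * flat m.+1 x).
Proof.
have [x0|x0|->] := ltgtP x 0.
- have fl k : flat k x = 0 by rewrite /flat ltNge ltW.
  rewrite !fl mulr0 subr0; apply: (@near_eq_is_derive _ _ _ (cst 0)).
    near=> y; rewrite /flat ifF//; apply/negbTE; rewrite -leNgt ltW//.
    by near: y; exact: lt_nbhsl.
- rewrite /flat x0; apply: (@near_eq_is_derive _ _ _
    (fun y : R => y^-1 ^+ m * expR (- y^-1))).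
    near=> y; rewrite ifT//; near: y; exact: lt_nbhsr.
  have xn0 : x != 0 by rewrite gt_eqF.
  have dV : is_derive x 1 (fun y : R => y^-1) (- x ^- 2 *: 1).
    exact: (@is_deriveV _ id x 1 1 xn0 (is_derive_id x 1)).
  have dE := @is_derive1_comp _ _ _ x _ _ (is_derive_expR (- x^-1)) (is_deriveN dV).
  have := is_deriveM (is_deriveX m dV) dE.
  rewrite (_ : _ * _ = fun y : R => y^-1 ^+ m * expR (- y^-1)); last first.
    by apply/funext => y; rewrite -[LHS]/(((fun y : R => y^-1) ^+ m) y * _) exprfctE.
  move/is_derive_eq; apply.
  rewrite exprfctE /GRing.scale /= mulr1 opprK -exprVn.
  case: m => [|m]; first by rewrite !expr0; ring.
  by rewrite /= !exprS; ring.
- have fl k : flat k 0 = 0 by rewrite /flat ltxx.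
  rewrite !fl mulr0 subr0.
  have C : (fun h : R => h^-1 *: ((flat m \o shift 0) (h *: 1) - flat m 0)) @ 0^' --> (0:R).
    apply: (@cvg_to_0_linear _ _ (m.+2)`!%:R 1) => // r /andP[r0 _].
    rewrite /= fl subr0 addr0 scaler1.
    apply: le_trans (flat_lin m r).
    rewrite /flat; case: ifPn => [rp|_]; last by rewrite scaler0 normr0.
    by rewrite exprS /GRing.scale /= mulrA.
  apply: DeriveDef; first by apply/cvg_ex; exists 0.
  by apply/cvg_lim.
Unshelve. all: by end_near. Qed.
End PartialDerivatives.

(** * Closure properties of smooth functions, and bump functions *)

Section SmoothFunctionsRn.
Context {R : realType}.

Lemma is_derive_bigsum (V W : normedModType R) (I : finType) (h : I -> V -> W)
    (dh : I -> W) (x v : V) :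
  (forall i, is_derive x v (h i) (dh i)) ->
  is_derive x v (fun y => \sum_i h i y) (\sum_i dh i).
Proof.
move=> H; rewrite (_ : (fun y => _) = \sum_i h i); last first.
  by apply/funext => y; rewrite fct_sumE.
elim/big_ind2 : _ => //; first exact: is_derive_cst.
by move=> a b c d Ha Hc; exact: is_deriveD.
Qed.

Lemma Cinf_cst n (U : set 'rV[R]_n) (a : R) : open U -> Cinf U (cst a).
Proof.
move=> oU; apply: (@Cinf_coind _ _ _ (fun f => exists b, f = cst b)) => //;
  last by exists a.
move=> _ [b ->]; split; first by move=> x _; exact: differentiable_cst.
by move=> i; exists (cst 0); [exists 0|move=> x _; rewrite derive_cst].
Qed.

(* This class is stable under partial derivatives, which yields all closure
   properties of [Cinf] at once through [Cinf_coind]. *)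
Inductive Ccl n (U : set 'rV[R]_n) : ('rV[R]_n -> R) -> Prop :=
| Ccl_base f of Cinf U f : Ccl U f
| Ccl_add f g of Ccl U f & Ccl U g : Ccl U (fun x => f x + g x)
| Ccl_mul f g of Ccl U f & Ccl U g : Ccl U (fun x => f x * g x)
| Ccl_inv f of Ccl U f & (forall x, U x -> f x != 0) : Ccl U (fun x => (f x)^-1)
| Ccl_flat m f of Ccl U f : Ccl U (flat m \o f)
| Ccl_comp p (V : set 'rV[R]_p) (phi : 'rV[R]_n -> 'rV[R]_p) f of
    open V & (forall x, U x -> V (phi x)) &
    (forall j, Ccl U (fun x => phi x 0 j)) & Cinf V f : Ccl U (f \o phi).

Lemma Ccl_sum n (U : set 'rV[R]_n) (I : finType) (h : I -> 'rV[R]_n -> R) :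
  open U -> (forall i, Ccl U (h i)) -> Ccl U (fun x => \sum_i h i x).
Proof.
move=> oU H; rewrite (_ : (fun y => _) = \sum_i h i); last first.
  by apply/funext => y; rewrite fct_sumE.
elim/big_ind : _ => // [|f g Cf Cg]; last exact: Ccl_add.
by apply: Ccl_base; exact: Cinf_cst.
Qed.

Lemma differentiable_rV n p (phi : 'rV[R]_n -> 'rV[R]_p) x :
  (forall j, differentiable (fun y => phi y 0 j) x) -> differentiable phi x.
Proof.
move=> H; rewrite (_ : phi = \sum_j (fun y => phi y 0 j *: ('e_j : 'rV[R]_p))).
  by apply: differentiable_sum => j; exact: differentiableZl.
by apply/funext => y; rewrite fct_sumE; exact: row_sum_delta.
Qed.

Lemma derive_comp_coord n p (phi : 'rV[R]_n -> 'rV[R]_p) (f : 'rV[R]_p -> R) x v :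
  (forall j, differentiable (fun y => phi y 0 j) x) -> differentiable f (phi x) ->
  'D_v (f \o phi) x =
  \sum_j 'D_v (fun y => phi y 0 j) x * 'D_'e_j f (phi x).
Proof.
move=> dphi df; have dp := differentiable_rV dphi.
rewrite deriveE; last exact: differentiable_comp.
rewrite diff_comp// /= -deriveE// derive_sum_coord//.
apply: eq_bigr => j _; congr (_ * _); rewrite -deriveE//.
by rewrite derive_mx ?mxE//; exact: diff_derivable.
Qed.

Lemma CclP n (U : set 'rV[R]_n) f : open U -> Ccl U f -> Cinf U f.
Proof.
move=> oU; apply: (Cinf_coind oU) => {}f; elim=> {f}.
- move=> f Cf; split; first by move=> x Ux; exact: (Cinf_differentiable oU Cf Ux).
  by move=> i; exists ('D_'e_i f) => //; apply: Ccl_base; exact: Cinf_D.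
- move=> f g Cf [df Df] Cg [dg Dg]; split.
    by move=> x Ux; apply: differentiableD; [exact: df|exact: dg].
  move=> i; have [f' Cf' fE] := Df i; have [g' Cg' gE] := Dg i.
  exists (fun x => f' x + g' x); first exact: Ccl_add.
  move=> x Ux; rewrite -fE// -gE//; apply: deriveD.
  + by apply: diff_derivable; exact: df.
  + by apply: diff_derivable; exact: dg.
- move=> f g Cf [df Df] Cg [dg Dg]; split.
    by move=> x Ux; apply: differentiableM; [exact: df|exact: dg].
  move=> i; have [f' Cf' fE] := Df i; have [g' Cg' gE] := Dg i.
  exists (fun x => f x * g' x + g x * f' x).
    by apply: Ccl_add; apply: Ccl_mul.
  move=> x Ux; rewrite -fE// -gE//; apply: deriveM.
  + by apply: diff_derivable; exact: df.
  + by apply: diff_derivable; exact: dg.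
- move=> f Cf [df Df] f0; split.
    by move=> x Ux; apply: differentiableV; [exact: df|exact: f0].
  move=> i; have [f' Cf' fE] := Df i.
  exists (fun x => (-1) * ((f x)^-1 * (f x)^-1) * f' x).
    apply: Ccl_mul => //; apply: Ccl_mul; first by apply: Ccl_base; exact: Cinf_cst.
    by apply: Ccl_mul; exact: Ccl_inv.
  move=> x Ux; rewrite deriveV; [|exact: f0|by apply: diff_derivable; exact: df].
  by rewrite fE// /GRing.scale /= mulN1r -expr2 exprVn.
- move=> m f Cf [df Df]; have dfl k y : differentiable (flat k) y.
    by apply/derivable1_diffP; have [] := is_derive_flat k y.
  split; first by move=> x Ux; apply: differentiable_comp => //; exact: df.
  move=> i; have [f' Cf' fE] := Df i.
  exists (fun x => f' x * ((flat m.+2 \o f) x + - m%:R * (flat m.+1 \o f) x)).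
    apply: Ccl_mul => //; apply: Ccl_add; first exact: Ccl_flat.
    by apply: Ccl_mul; [apply: Ccl_base; exact: Cinf_cst|exact: Ccl_flat].
  move=> x Ux; rewrite deriveE; last by apply: differentiable_comp => //; exact: df.
  rewrite diff_comp//; last exact: df.
  rewrite /= diff1E// derive1E.
  rewrite (@derive_val _ _ _ _ _ _ _ (is_derive_flat m (f x))).
  by rewrite -deriveE ?fE//; [rewrite /= mulNr|exact: df].
- move=> p V phi f oV UV Cphi H Cf.
  have dphi x : U x -> forall j, differentiable (fun y => phi y 0 j) x.
    by move=> Ux j; have [d _] := H j; exact: d.
  have df x : U x -> differentiable f (phi x).
    by move=> Ux; apply: (Cinf_differentiable oV Cf); exact: UV.
  split.
    move=> x Ux; apply: differentiable_comp; last exact: df.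
    by apply: differentiable_rV; exact: dphi.
  move=> i.
  have /choice[g gP] : forall j, exists g, Ccl U g /\
      forall x, U x -> 'D_'e_i (fun y => phi y 0 j) x = g x.
    by move=> j; have [_ /(_ i)[g]] := H j; exists g.
  (* Chain rule: ['D_'e_j f] is again smooth on [V], so the composition constructor applies to
     it. *)
  exists (fun x => \sum_j g j x * ('D_'e_j f \o phi) x).
    apply: Ccl_sum => // j; apply: Ccl_mul; first by have [] := gP j.
    by apply: Ccl_comp oV UV Cphi _; exact: Cinf_D.
  move=> x Ux; rewrite derive_comp_coord//; [|exact: dphi|exact: df].
  by apply: eq_bigr => j _; rewrite (gP j).2.
Qed.

Lemma CinfD n (U : set 'rV[R]_n) f g : open U -> Cinf U f -> Cinf U g ->
  Cinf U (fun x => f x + g x).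
Proof. by move=> oU Cf Cg; apply: CclP => //; apply: Ccl_add; apply: Ccl_base. Qed.

Lemma CinfM n (U : set 'rV[R]_n) f g : open U -> Cinf U f -> Cinf U g ->
  Cinf U (fun x => f x * g x).
Proof. by move=> oU Cf Cg; apply: CclP => //; apply: Ccl_mul; apply: Ccl_base. Qed.

Lemma CinfV n (U : set 'rV[R]_n) f : open U -> Cinf U f ->
  (forall x, U x -> f x != 0) -> Cinf U (fun x => (f x)^-1).
Proof. by move=> oU Cf f0; apply: CclP => //; apply: Ccl_inv => //; apply: Ccl_base. Qed.

Lemma Cinf_comp n p (U : set 'rV[R]_n) (V : set 'rV[R]_p)
    (phi : 'rV[R]_n -> 'rV[R]_p) f : open U -> open V ->
  (forall x, U x -> V (phi x)) -> (forall j, Cinf U (fun x => phi x 0 j)) ->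
  Cinf V f -> Cinf U (f \o phi).
Proof.
move=> oU oV UV Cphi Cf; apply: CclP => //; apply: Ccl_comp oV UV _ Cf => j.
exact: Ccl_base.
Qed.

Lemma derive_coord n (a x : 'rV[R]_n) i : 'D_a (fun z : 'rV[R]_n => z 0 i) x = a 0 i.
Proof.
have dx : differentiable (@id 'rV[R]_n) x by [].
have := derive_mx (@diff_derivable _ _ _ _ _ a dx).
by rewrite derive_id => /rowP/(_ i); rewrite [RHS]mxE => ->.
Qed.

Lemma Cinf_coord n (U : set 'rV[R]_n) j : open U -> Cinf U (fun x => x 0 j).
Proof.
move=> oU; apply: (@Cinf_coind _ _ _ (fun f => f = (fun x => x 0 j) \/ Cinf U f)) => //;
  last by left.
move=> f [->|Cf]; split; try by move=> x Ux; exact: (Cinf_differentiable oU Cf Ux).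
- by move=> x _; exact: differentiable_coord.
- move=> i; exists (cst (('e_i : 'rV[R]_n) 0 j)); first by right; exact: Cinf_cst.
  by move=> x _; rewrite derive_coord.
- by move=> i; exists ('D_'e_i f) => //; right; exact: Cinf_D.
Qed.

(** [theta] is the quotient of [flat 0 u] by [flat 0 u + flat 0 w], with [r] the squared Euclidean
    distance to [x], [u = d^2 - r] and [w = r - d^2/2]. Since [d^2/2 < d^2], one of [u] and [w] is
    positive at each point, hence so is the denominator. *)
Lemma bump_rV n (x : 'rV[R]_n) (d : R) : 0 < d -> exists theta : 'rV[R]_n -> R,
  [/\ Cinf setT theta, \forall y \near x, theta y = 1 &
      forall y, d <= `|y - x| -> theta y = 0].
Proof.
move=> d0; pose r (y : 'rV[R]_n) := \sum_i (y 0 i - x 0 i) * (y 0 i - x 0 i).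
pose a := d ^+ 2 / 2.
pose u y := d ^+ 2 + (-1) * r y.
pose w y := r y + - a.
have oT : open [set: 'rV[R]_n] by exact: openT.
have Cc b : Ccl [set: 'rV[R]_n] (cst b) by apply: Ccl_base; exact: Cinf_cst.
have Cr : Ccl setT r.
  apply: Ccl_sum => // i; have C : Ccl setT (fun y : 'rV[R]_n => y 0 i - x 0 i).
    apply: Ccl_add; last exact: (Cc (- x 0 i)).
    by apply: Ccl_base; exact: Cinf_coord.
  exact: Ccl_mul.
have Cu : Ccl setT u.
  by apply: Ccl_add; [exact: (Cc (d ^+ 2))|apply: Ccl_mul => //; exact: (Cc (-1))].
have Cw : Ccl setT w by apply: Ccl_add => //; exact: (Cc (- a)).
have ad : a < d ^+ 2 by rewrite /a gtr_pMr ?exprn_gt0// invf_lt1 ?ltr1n.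
have den y : 0 < (flat 0 \o u) y + (flat 0 \o w) y.
  have [uy|uy] := ltP 0 (u y).
    by rewrite ltr_pwDl ?flat_ge0// /flat /= uy mulr_gt0 ?expR_gt0.
  rewrite ltr_wpDl ?flat_ge0// /flat /= ifT ?mulr_gt0 ?expR_gt0//.
  by rewrite /w subr_gt0 (lt_le_trans ad)//; move: uy; rewrite /u; lra.
exists (fun y => (flat 0 \o u) y * ((flat 0 \o u) y + (flat 0 \o w) y)^-1); split.
- apply: CclP => //; apply: Ccl_mul; first exact: Ccl_flat.
  apply: Ccl_inv; last by move=> y _; rewrite gt_eqF.
  by apply: Ccl_add; exact: Ccl_flat.
- have rx : r x = 0 by apply: big1 => i _; rewrite subrr mulr0.
  have cr : {for x, continuous r}.
    by apply: differentiable_continuous; exact: (Cinf_differentiable oT (CclP oT Cr)).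
  have a0 : 0 < a by rewrite divr_gt0 ?exprn_gt0.
  have : \forall y \near x, r y < a.
    by have /(@cvgr_lt R _ (nbhs x) _ r (r x)) := cr; apply; rewrite rx.
  apply: filterS => y ya; have -> : (flat 0 \o w) y = 0.
    by rewrite /flat /= /w ifF//; apply/negbTE; rewrite -leNgt subr_le0 ltW.
  rewrite addr0 divff// gt_eqF//; have := den y; rewrite {2}/flat /= /w.
  by rewrite ifF ?addr0//; apply/negbTE; rewrite -leNgt subr_le0 ltW.
- move=> y dy; rewrite {1}/flat /= ifF ?mul0r//; apply/negbTE; rewrite -leNgt.
  rewrite /u mulN1r subr_le0.
  (* A maximum norm of at least [d] is reached in one coordinate, which alone makes [r y] at least
     [d^2]. *)
  have [i yi] : exists i, d <= `|y 0 i - x 0 i|.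
    apply: contrapT => /forallNP H.
    have : `|y - x| < d; last by rewrite ltNge dy.
    rewrite [ltLHS]/Num.Def.normr /= mx_normrE; apply: bigmax_lt => // -[k j] _ /=.
    by rewrite ord1 !mxE ltNge; apply/negP; exact: H.
  rewrite /r (bigD1 i)//= ler_wpDr ?sumr_ge0//.
    by move=> j _; rewrite -expr2 sqr_ge0.
  rewrite -expr2 -[leRHS]real_normK ?num_real//; apply: lerXn2r => //.
  by rewrite nnegrE ltW.
Qed.

End SmoothFunctionsRn.

(** * Symmetry of second derivatives, and Gronwall's inequality *)

Section SecondDerivatives.
Context {R : realType}.

Lemma is_derive_translate n (f : 'rV[R]_n -> R) (a x v : 'rV[R]_n) :
  derivable f (x + a) v ->
  is_derive x v (fun y => f (y + a)) ('D_v f (x + a)).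
Proof.
move=> df.
have E : (fun h : R => h^-1 *: (((fun y => f (y + a)) \o shift x) (h *: v) - f (x + a)))
  = (fun h : R => h^-1 *: ((f \o shift (x + a)) (h *: v) - f (x + a))).
  by apply/funext => h /=; rewrite addrA.
by apply: DeriveDef; rewrite /derivable /derive E.
Qed.

(** The mean value theorem is applied twice: to [G], the increment of [f] along [e_i], in direction
    [e_j], then to ['D_'e_j f] in direction [e_i]. The condition [2 * s < d] keeps the whole square
    in the ball. *)
Lemma second_difference n (f : 'rV[R]_n -> R) (x : 'rV[R]_n) (i j : 'I_n) (s d : R) :
  0 < s -> 2 * s < d ->
  (forall y, `|y - x| < d -> derivable f y 'e_j) ->
  (forall y, `|y - x| < d -> derivable ('D_'e_j f) y 'e_i) ->
  exists2 z, `|z - x| < d &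
    f (x + s *: 'e_j + s *: 'e_i) - f (x + s *: 'e_j) -
      (f (x + s *: 'e_i) - f x) = s ^+ 2 * 'D_'e_i ('D_'e_j f) z.
Proof.
move=> s0 sd df ddf.
have bnd (k l : 'I_n) (t u : R) : 0 <= t <= 1 -> 0 <= u <= 1 ->
    `|x + t *: (s *: 'e_k) + u *: (s *: 'e_l) - x| < d.
  move=> /andP[t0 t1] /andP[u0 u1]; rewrite addrAC [x + _]addrC addrK.
  apply: le_lt_trans (ler_normD _ _) _; apply: le_lt_trans sd.
  have sm (m : 'I_n) (w : R) : 0 <= w -> w <= 1 -> `|w *: (s *: ('e_m : 'rV[R]_n))| <= s.
    move=> w0 w1; apply: rV_norm_le; first exact: ltW.
    move=> o; rewrite !mxE eqxx /= normrM (ger0_norm w0) normrM (gtr0_norm s0).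
    rewrite mulrA -[leRHS]mulr1 ler_pM ?mulr_ge0 ?(ltW s0)// ?ler_piMl ?(ltW s0)//.
    by case: (o == m); rewrite ?normr1 ?normr0.
  by rewrite mulr_natl mulr2n lerD ?sm.
pose G (y : 'rV[R]_n) := f (y + s *: 'e_i) - f y.
have I1 : 0 <= (1 : R) <= 1 by rewrite ler01 lexx.
have I0 : 0 <= (0 : R) <= 1 by rewrite ler01 lexx.
have dG (t : R) : 0 <= t <= 1 -> is_derive (x + t *: (s *: 'e_j)) 'e_j G
   ('D_'e_j f (x + t *: (s *: 'e_j) + s *: 'e_i) - 'D_'e_j f (x + t *: (s *: 'e_j))).
  move=> tI; apply: is_deriveB.
    by apply/is_derive_translate/df; have := bnd j i t 1 tI I1; rewrite scale1r.
  apply/derivableP/df; have := bnd j i t 0 tI I0.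
  by rewrite scale0r addr0.
have [t tI] := @MVT_line R n G x (s *: 'e_j) (fun t tI =>
  @ex_derive _ _ _ _ _ _ _ (is_deriveZv s (@ex_derive _ _ _ _ _ _ _ (dG t tI)))).
rewrite (@derive_val _ _ _ _ _ _ _ (is_deriveZv s (@ex_derive _ _ _ _ _ _ _ (dG t tI)))).
rewrite (@derive_val _ _ _ _ _ _ _ (dG t tI)) /G => ->.
have dH (u : R) : 0 <= u <= 1 ->
    derivable ('D_'e_j f) (x + t *: (s *: 'e_j) + u *: (s *: 'e_i)) 'e_i.
  by move=> uI; apply/ddf/bnd.
have [u uI ->] := @MVT_line R n ('D_'e_j f) (x + t *: (s *: 'e_j)) (s *: 'e_i)
  (fun u uI => @ex_derive _ _ _ _ _ _ _ (is_deriveZv s (dH u uI))).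
rewrite (@derive_val _ _ _ _ _ _ _ (is_deriveZv s (dH u uI))).
exists (x + t *: (s *: 'e_j) + u *: (s *: 'e_i)); first exact: bnd.
by rewrite mulrA expr2.
Qed.

(** The second difference is symmetric in [i] and [j], so one mixed derivative at some [z] equals
    the other at some [w]. Both points are so close to [x] that each derivative is within [e / 2] of
    its value at [x]. *)
Lemma derive_comm n (U : set 'rV[R]_n) (f : 'rV[R]_n -> R) x (i j : 'I_n) :
  open U -> Cinf U f -> U x -> 'D_'e_i ('D_'e_j f) x = 'D_'e_j ('D_'e_i f) x.
Proof.
move=> oU Cf Ux; apply/eqP; rewrite -subr_eq0 -normr_le0; apply/ler_addgt0Pr => e e0.
rewrite add0r.
have cD k l : {for x, continuous ('D_'e_k ('D_'e_l f))}.
  by have [c _] := Cinf_D k (Cinf_D l Cf) 0%N; exact: c.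
have e20 : 0 < e / 2 by rewrite divr_gt0.
have near_D k l : \forall y \near x,
    `|'D_'e_k ('D_'e_l f) x - 'D_'e_k ('D_'e_l f) y| <= e / 2.
  by have /cvgrPdist_le/(_ _ e20) := cD k l.
have : \forall y \near x, [/\ U y,
    `|'D_'e_i ('D_'e_j f) x - 'D_'e_i ('D_'e_j f) y| <= e / 2 &
    `|'D_'e_j ('D_'e_i f) x - 'D_'e_j ('D_'e_i f) y| <= e / 2].
  have nU : nbhs x U by exact: open_nbhs_nbhs.
  by apply: filterS3 nU (near_D i j) (near_D j i) => y; split.
move=> /nbhs_ballP[d /= d0 dP].
have {}dP y : `|y - x| < d -> [/\ U y,
    `|'D_'e_i ('D_'e_j f) x - 'D_'e_i ('D_'e_j f) y| <= e / 2 &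
    `|'D_'e_j ('D_'e_i f) x - 'D_'e_j ('D_'e_i f) y| <= e / 2].
  by move=> yx; apply: dP; rewrite -ball_normE /ball_ /= distrC.
pose s := d / 4; have s0 : 0 < s by rewrite divr_gt0.
have sd : 2 * s < d by rewrite /s; lra.
have df k y : `|y - x| < d -> derivable f y 'e_k.
  by move=> /dP[Uy _ _]; have [_ /(_ k)[D _]] := Cf 1%N; exact: D.
have ddf k l y : `|y - x| < d -> derivable ('D_'e_l f) y 'e_k.
  by move=> /dP[Uy _ _]; have [_ /(_ k)[D _]] := Cinf_D l Cf 1%N; exact: D.
have [z /dP[_ z1 _] zE] := second_difference (i := i) (j := j) s0 sd (df j) (ddf i j).
have [w /dP[_ _ w1] wE] := second_difference (i := j) (j := i) s0 sd (df i) (ddf j i).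
have zw : 'D_'e_i ('D_'e_j f) z = 'D_'e_j ('D_'e_i f) w.
  have s20 : s ^+ 2 != 0 by rewrite expf_neq0// gt_eqF.
  apply: (mulfI s20); rewrite -zE -wE [x + _ + _]addrAC.
  by ring.
rewrite (splitr e) -(subrKA ('D_'e_i ('D_'e_j f) z)).
apply: le_trans (ler_normD _ _) _; apply: lerD; first exact: z1.
rewrite zw distrC; exact: w1.
Qed.

(* Gronwall: [t |-> exp (- c t) * \sum_j (s_j (x + t (y - x)))^2] does not
   increase. *)
Lemma gronwall n (I : finType) (s : I -> 'rV[R]_n -> R) (x : 'rV[R]_n) (d C : R) :
  (forall j, s j x = 0) ->
  (forall j y, `|y - x| < d -> differentiable (s j) y) ->
  (forall j i y, `|y - x| < d -> `|'D_'e_i (s j) y| <= C * \sum_k `|s k y|) ->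
  forall j y, `|y - x| < d -> s j y = 0.
Proof.
move=> sx ds bs j y yd; pose v := y - x.
pose p (t : R) := x + t *: v.
have pd (t : R) : 0 <= t <= 1 -> `|p t - x| < d.
  move=> /andP[t0 t1]; rewrite /p [x + _]addrC addrK normrZ ger0_norm//.
  by apply: le_lt_trans yd; rewrite ler_piMl.
pose phi (t : R) := \sum_k s k (p t) * s k (p t).
pose dphi (t : R) := \sum_k (s k (p t) * 'D_v (s k) (p t) + s k (p t) * 'D_v (s k) (p t)).
have dP (t : R) : 0 <= t <= 1 -> is_derive t 1 phi (dphi t).
  move=> tI; apply: is_derive_bigsum => k.
  have H : is_derive t 1 (fun u => s k (p u)) ('D_v (s k) (p t)).
    by apply: is_derive_line; apply: diff_derivable; apply: ds; exact: pd.
  exact: (is_deriveM H H).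
have C1 : exists c : R, forall t : R, 0 <= t <= 1 -> dphi t <= c * phi t.
  (* [c1] bounds ['D_v (s k)] through the [n] coordinates of [v]; the absolute value of [C] keeps it
     nonnegative. The factor [2 * #|I|] comes from [2ab <= a^2 + b^2], summed over all pairs of
     indices. *)
  pose c1 := n%:R * `|v| * `|C|.
  exists (2 * #|I|%:R * c1) => t tI.
  have Dv k : `|'D_v (s k) (p t)| <= c1 * \sum_l `|s l (p t)|.
    rewrite derive_sum_coord; last by apply: ds; exact: pd.
    apply: le_trans (ler_norm_sum _ _ _) _.
    apply: (@le_trans _ _ (\sum_(i < n) `|v| * (`|C| * \sum_l `|s l (p t)|))).
      apply: ler_sum => i _; rewrite normrM ler_pM//; first exact: rV_coord_le.
      apply: le_trans (bs _ _ _ (pd _ tI)) _.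
      by rewrite ler_wpM2r ?ler_norm// sumr_ge0.
    by rewrite sumr_const card_ord -mulr_natl /c1 !mulrA.
  have c10 : 0 <= c1 by rewrite !mulr_ge0.
  rewrite /dphi /phi.
  apply: (@le_trans _ _ (\sum_k \sum_l c1 * (s k (p t) ^+ 2 + s l (p t) ^+ 2))).
    apply: ler_sum => k _; rewrite -mulr2n -mulr_natl.
    apply: le_trans (ler_norm _) _; rewrite !normrM ger0_norm//.
    apply: (@le_trans _ _ (2 * (`|s k (p t)| * (c1 * \sum_l `|s l (p t)|)))).
      by rewrite ler_pM2l// ler_wpM2l.
    rewrite mulr_sumr mulr_sumr mulr_sumr; apply: ler_sum => l _.
    rewrite -[s k _ ^+ 2]real_normK ?num_real// -[s l _ ^+ 2]real_normK ?num_real//.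
    move: (`|s k (p t)|) (`|s l (p t)|) => a b.
    have -> : 2 * (a * (c1 * b)) = c1 * (2 * a * b) by ring.
    rewrite ler_wpM2l//; have := sqr_ge0 (a - b); rewrite sqrrB; lra.
  under eq_bigr do rewrite -mulr_sumr big_split /= sumr_const.
  rewrite -mulr_sumr big_split /= sumr_const.
  under eq_bigr do rewrite -mulr_natl.
  rewrite -mulr_sumr -mulr_natl.
  under [X in _ <= _ * X]eq_bigr do rewrite -expr2.
  rewrite le_eqVlt; apply/orP; left; apply/eqP; ring.
have [c cP] := C1.
pose psi (t : R) := expR (- c * t) * phi t.
have dpsi (t : R) : 0 <= t <= 1 -> is_derive t 1 psi (expR (- c * t) * (dphi t - c * phi t)).
  move=> tI.
  have dl : is_derive t 1 (fun u : R => - c * u) (- c).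
    have := @is_deriveZ R R R id (- c) t 1 1 (is_derive_id t 1).
    by rewrite /GRing.scale /= mulr1.
  have de := @is_derive1_comp R _ _ t _ _ (is_derive_expR (- c * t)) dl.
  have := is_deriveM de (dP t tI); move/is_derive_eq; apply.
  by rewrite /GRing.scale /=; ring.
have : psi 1 <= psi 0.
  apply: (@ler0_derive1_nincr R psi 0 1) => //.
  - move=> t /[!in_itv]/= /andP[t0 t1].
    by apply: (@ex_derive _ _ _ _ _ _ _ (dpsi t _)); rewrite !ltW.
  - move=> t /[!in_itv]/= /andP[t0 t1]; have tI : 0 <= t <= 1 by rewrite !ltW.
    rewrite derive1E (@derive_val _ _ _ _ _ _ _ (dpsi t tI)).
    by rewrite mulr_ge0_le0 ?expR_ge0// subr_le0 cP.
  - apply: derivable_within_continuous => t /[!in_itv]/= tI.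
    exact: (@ex_derive _ _ _ _ _ _ _ (dpsi t tI)).
have -> : psi 0 = 0.
  rewrite /psi /phi /p scale0r addr0 big1 ?mulr0// => k _.
  by rewrite sx mulr0.
rewrite /psi pmulr_rle0 ?expR_gt0//.
have p1 : p 1 = y by rewrite /p scale1r /v addrC subrK.
rewrite /phi p1 => H.
have : \sum_k s k y * s k y == 0.
  by rewrite eq_le H sumr_ge0// => k _; rewrite -expr2 sqr_ge0.
rewrite psumr_eq0; last by move=> k _; rewrite -expr2 sqr_ge0.
by move=> /allP/(_ j (mem_index_enum _)) /=; rewrite mulf_eq0 orbb => /eqP.
Qed.

End SecondDerivatives.

(** * Smooth functions and tangent vectors *)

Section SmoothFunctions.
Context {R : realType} {n : nat} {M : manifold R n}.
Implicit Types (q : M) (W A : set M) (f g : M -> R) (c : chart R n M).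

Lemma chart_image_open c A : open A -> A `<=` cdom c -> open (cmap c @` A).
Proof.
move=> oA Ac; rewrite openE => _ [q Aq <-]; rewrite /interior /=.
have imq : (cmap c @` cdom c) (cmap c q) by exists q => //; exact: Ac.
have n1 : nbhs (cmap c q) (cmap c @` cdom c).
  by apply: open_nbhs_nbhs; split => //; exact: cimg_open.
have n2 : nbhs (cmap c q) (cinv c @^-1` A).
  apply: (cinv_continuous imq); rewrite cmapK; last exact: Ac.
  exact: open_nbhs_nbhs.
apply: filterS2 n1 n2 => _ [q' cq' <-] /=; rewrite cmapK// => Aq'.
by exists q'.
Qed.

Lemma chart_preimage_open c (U : set 'rV[R]_n) :
  open U -> open (cdom c `&` cmap c @^-1` U).
Proof.
move=> oU; rewrite openE => q [cq Uq].
have n1 : nbhs q (cdom c) by apply: open_nbhs_nbhs; split=> //; exact: cdom_open.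
have n2 : nbhs q (cmap c @^-1` U).
  by apply: (cmap_continuous cq); exact: open_nbhs_nbhs.
exact: filterS2 n1 n2.
Qed.

(** [smooth_on] quantifies over all charts; the smooth transition maps reduce it to one chart around
    each point. *)
Lemma smooth_on_local W f : open W ->
  (forall q, W q -> exists c, exists U : set 'rV[R]_n, exists F,
    [/\ atlas c /\ cdom c q, open U /\ U (cmap c q), Cinf U F &
        forall q', cdom c q' -> W q' -> U (cmap c q') -> f q' = F (cmap c q')]) ->
  smooth_on W f.
Proof.
move=> oW H c' ac'; apply: Cinf_local => _ [q [cq' Wq] <-].
have [c [U [F [[ac cq] [oU Uq] CF fF]]]] := H q Wq.
pose A := (cdom c' `&` W) `&` (cdom c `&` cmap c @^-1` U).
have oA : open A.
  apply: openI; last exact: chart_preimage_open.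
  by apply: openI => //; exact: cdom_open.
have oV : open (cmap c' @` A).
  by apply: chart_image_open oA _ => x [[? _] _].
exists (cmap c' @` A); first by exists q.
apply: (Cinf_eq (f := F \o (fun x => cmap c (cinv c' x)))) => //.
  by move=> _ [x [[cx' Wx] [cx Ux]] <-] /=; rewrite cmapK// fF.
apply: (Cinf_comp oV oU _ _ CF).
  by move=> _ [x [[cx' Wx] [cx Ux]] <-]; rewrite cmapK.
move=> j; apply: Cinf_sub (atlas_compatible ac' ac j).
by move=> _ [x [[cx' Wx] [cx Ux]] <-]; exists x.
Qed.

Lemma smooth_on_sub (W W' : set M) f : W' `<=` W -> smooth_on W f -> smooth_on W' f.
Proof.
move=> WW' sf c ac; apply: Cinf_sub (sf c ac) => _ [x [cx Wx] <-].
by exists x => //; split=> //; exact: WW'.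
Qed.

Definition smooth_near q f := exists W, [/\ open W, W q & smooth_on W f].

Lemma smooth_near_smooth f : (forall q, smooth_near q f) -> smooth f.
Proof.
move=> sf c ac; apply: Cinf_local => _ [q [cq _] <-].
have [W [oW Wq sW]] := sf q.
by exists (cmap c @` (cdom c `&` W)); [exists q|exact: sW].
Qed.

Lemma smooth_smooth_near q f : smooth f -> smooth_near q f.
Proof. by move=> sf; exists setT; split => //; exact: openT. Qed.

Lemma smooth_near_eq q f g : (\forall q' \near q, f q' = g q') ->
  smooth_near q f -> smooth_near q g.
Proof.
rewrite /prop_near1 nbhsE => -[W' [oW' Wq'] fg] [W [oW Wq sf]].
have oI : open (W `&` W') by exact: openI.
exists (W `&` W'); split => // c ac.
apply: (Cinf_eq (f := f \o cinv c)).
- by apply: chart_image_open; [apply: openI => //; exact: cdom_open|move=> x []].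
- by move=> _ [x [cx [Wx Wx']] <-]; rewrite /= cmapK// fg.
- by apply: (smooth_on_sub _ sf) => // x [].
Qed.

Let image_open c W : open W -> open (cmap c @` (cdom c `&` W)).
Proof.
move=> oW; apply: chart_image_open; last by move=> x [].
by apply: openI => //; exact: cdom_open.
Qed.

Lemma smooth_nearD q f g : smooth_near q f -> smooth_near q g ->
  smooth_near q (fun x => f x + g x).
Proof.
move=> [W [oW Wq sf]] [W' [oW' Wq' sg]]; exists (W `&` W'); split => //.
  exact: openI.
have sf' : smooth_on (W `&` W') f by apply: (smooth_on_sub _ sf) => x [].
have sg' : smooth_on (W `&` W') g by apply: (smooth_on_sub _ sg) => x [].
move=> c ac; apply: CinfD; [by apply: image_open; exact: openI|exact: sf'|exact: sg'].
Qed.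

Lemma smooth_nearM q f g : smooth_near q f -> smooth_near q g ->
  smooth_near q (fun x => f x * g x).
Proof.
move=> [W [oW Wq sf]] [W' [oW' Wq' sg]]; exists (W `&` W'); split => //.
  exact: openI.
have sf' : smooth_on (W `&` W') f by apply: (smooth_on_sub _ sf) => x [].
have sg' : smooth_on (W `&` W') g by apply: (smooth_on_sub _ sg) => x [].
move=> c ac; apply: CinfM; [by apply: image_open; exact: openI|exact: sf'|exact: sg'].
Qed.

Lemma smoothD f g : smooth f -> smooth g -> smooth (fun x => f x + g x).
Proof.
by move=> sf sg; apply: smooth_near_smooth => q;
  apply: smooth_nearD; exact: smooth_smooth_near.
Qed.

Lemma smoothM f g : smooth f -> smooth g -> smooth (fun x => f x * g x).
Proof.
by move=> sf sg; apply: smooth_near_smooth => q;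
  apply: smooth_nearM; exact: smooth_smooth_near.
Qed.

Lemma smooth_cst (a : R) : smooth (cst a : M -> R).
Proof. by move=> c ac; apply: Cinf_cst; apply: image_open; exact: openT. Qed.

Lemma smooth_sum (I : finType) (F : I -> M -> R) :
  (forall i, smooth (F i)) -> smooth (fun x => \sum_i F i x).
Proof.
move=> sF; rewrite (_ : (fun x => _) = \sum_i F i); last first.
  by apply/funext => y; rewrite fct_sumE.
elim/big_ind : _ => // [|f g sf sg]; first exact: (smooth_cst 0).
exact: smoothD.
Qed.

Lemma smooth_prod (I : finType) (F : I -> M -> R) :
  (forall i, smooth (F i)) -> smooth (fun x => \prod_i F i x).
Proof.
move=> sF; rewrite (_ : (fun x => _) = \prod_i F i); last first.
  by apply/funext => y; rewrite fct_prodE.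
elim/big_ind : _ => // [|f g sf sg]; first exact: (smooth_cst 1).
exact: smoothM.
Qed.

Lemma smooth_continuous f : smooth f -> continuous f.
Proof.
move=> sf q; have [c ac cq] := atlas_cover q.
have [Cf _] := sf c ac 0%N.
have fc : {for cmap c q, continuous (f \o cinv c)} by apply: Cf; exists q.
have fcc : {for q, continuous ((f \o cinv c) \o cmap c)}.
  by apply: continuous_comp => //; exact: cmap_continuous.
have E : {near q, f =1 (f \o cinv c) \o cmap c}.
  have : nbhs q (cdom c) by apply: open_nbhs_nbhs; split=> //; exact: cdom_open.
  by apply: filterS => x cx /=; rewrite cmapK.
rewrite /continuous_at; have -> : f q = ((f \o cinv c) \o cmap c) q.
  by rewrite /= cmapK.
by apply: cvg_trans fcc; apply: near_eq_cvg; apply: filterS E => x ->.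
Qed.

Lemma smooth_near_inv q f : smooth f -> f q != 0 -> smooth_near q (fun x => (f x)^-1).
Proof.
move=> sf fq; have cf := smooth_continuous sf.
have oW : open (f @^-1` [set y | y != 0]).
  by apply: open_comp => [x _|]; [exact: cf|exact: open_neq].
exists (f @^-1` [set y | y != 0]); split => // c ac.
apply: CinfV; [exact: image_open|by apply: (smooth_on_sub _ sf) ac|].
by move=> _ [x [cx fx] <-] /=; rewrite cmapK.
Qed.

(** [C] is the image of a closed ball under the inverse of a chart: compact, hence closed because
    [M] is Hausdorff. This makes the extension by 0 outside the chart smooth. *)
Lemma smooth_bump q (N : set M) : nbhs q N -> exists phi, exists C : set M,
  [/\ smooth phi, \forall q' \near q, phi q' = 1, closed C, C `<=` N &
      forall x, ~ C x -> phi x = 0].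
Proof.
rewrite nbhsE => -[A [oA Aq] AN]; have [c ac cq] := atlas_cover q.
have : nbhs (cmap c q) (cmap c @` (cdom c `&` A)).
  by apply: open_nbhs_nbhs; split; [exact: image_open|exists q].
move=> /nbhs_ballP[d /= d0 dP]; have d20 : 0 < d / 2 by rewrite divr_gt0.
have [theta [Ct t1 t0]] := bump_rV (cmap c q) d20.
pose B := [set y : 'rV[R]_n | `|y - cmap c q| <= d / 2].
have BA : B `<=` cmap c @` (cdom c `&` A).
  move=> y By; apply: dP; rewrite -ball_normE /ball_ /= distrC.
  by apply: le_lt_trans By _; lra.
have cB : compact B.
  apply: bounded_closed_compact.
    exists (`|cmap c q| + d / 2); split; first exact: num_real.
    move=> r rq y By; rewrite -[y](subrK (cmap c q)) addrC.
    apply: le_trans (ler_normD _ _) _; apply: le_trans (ltW rq).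
    by rewrite lerD2l.
  have -> : B = closed_ball (cmap c q) (d / 2).
    by rewrite closed_ballE//; apply/seteqP; split=> y; rewrite /closed_ball_ /= distrC.
  exact: closed_ball_closed.
pose C := cinv c @` B.
have CA : C `<=` cdom c `&` A by move=> _ [_ /BA[x cAx <-] <-]; rewrite cmapK//; case: cAx.
have cC : closed C.
  apply: compact_closed; first exact: manifold_hausdorff.
  apply: continuous_compact => //.
  apply: continuous_in_subspaceT => y /[!inE]/BA[x [cx Ax] <-].
  by apply: cinv_continuous; exists x.
have outC x : cdom c x -> ~ C x -> theta (cmap c x) = 0.
  move=> cx nCx; apply: t0; rewrite leNgt; apply/negP => H; apply: nCx.
  by exists (cmap c x); [exact: ltW|rewrite cmapK].
exists (fun x => if `[< cdom c x >] then theta (cmap c x) else 0), C; split => //.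
- apply: smooth_on_local; first exact: openT.
  move=> x _; have [Cx|nCx] := pselect (C x).
    exists c, setT, theta; split => //; first by have [] := CA _ Cx.
      by split=> //; exact: openT.
    by move=> y cy _ _; case: asboolP.
  have [c' ac' cx'] := atlas_cover x.
  exists c', (cmap c' @` (cdom c' `&` ~` C)), (cst 0).
  have oC : open (cmap c' @` (cdom c' `&` ~` C)).
    by apply: image_open; exact: closed_openC.
  split => //; first by split => //; exists x.
    exact: Cinf_cst.
  move=> y cy' _ [z [cz' nCz] zy].
  have -> : y = z by rewrite -(cmapK cy') -zy cmapK.
  by case: asboolP => // cz; exact: outC.
- have n1 : nbhs q (cdom c) by apply: open_nbhs_nbhs; split=> //; exact: cdom_open.
  have n2 : \forall x \near q, theta (cmap c x) = 1.
    exact: (cmap_continuous cq) t1.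
  by apply: filterS2 n1 n2 => x cx tx; case: asboolP.
- by move=> x /CA[_ /AN].
- by move=> x nCx; case: asboolP => // cx; exact: outC.
Qed.

(** Tangent vectors see only globally smooth functions, so local ones such as coordinates must be
    made global without changing their germ. *)
Lemma smooth_near_extend q f : smooth_near q f ->
  exists2 g, smooth g & \forall q' \near q, g q' = f q'.
Proof.
move=> [W [oW Wq sW]].
have [phi [C [sphi phi1 cC CW phi0]]] := smooth_bump (open_nbhs_nbhs (conj oW Wq)).
exists (fun x => phi x * f x).
  apply: smooth_near_smooth => x; have [Wx|nWx] := pselect (W x).
    by apply: smooth_nearM; [exact: smooth_smooth_near|exists W].
  apply: (@smooth_near_eq _ (cst 0)); last by apply/smooth_smooth_near/smooth_cst.
  have nCx : (~` C) x by move=> /CW.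
  have : nbhs x (~` C) by apply: open_nbhs_nbhs; split => //; exact: closed_openC.
  by apply: filterS => y /phi0 ->; rewrite mul0r.
by apply: filterS phi1 => x ->; rewrite mul1r.
Qed.

Lemma smooth_inv q f : smooth f -> f q != 0 ->
  exists2 g, smooth g & \forall q' \near q, f q' * g q' = 1.
Proof.
move=> sf fq; have [g sg gE] := smooth_near_extend (smooth_near_inv sf fq).
exists g => //; have : \forall q' \near q, f q' != 0.
  have oW : open (f @^-1` [set y | y != 0]).
    by apply: open_comp => [x _|]; [exact: smooth_continuous|exact: open_neq].
  exact: (open_nbhs_nbhs (conj oW fq)).
by apply: filterS2 gE => x -> fx; rewrite divff.
Qed.

End SmoothFunctions.

(** * Tangent vectors as derivations, coordinate fields, tensors *)

Section TangentVectors.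
Context {R : realType} {n : nat} {M : manifold R n}.
Implicit Types (p q : M) (f g : M -> R) (c : chart R n M) (v w : tvec M).

Lemma smooth_det m (A : M -> 'M[R]_m) :
  (forall i j, smooth (fun x => A x i j)) -> smooth (fun x => \det (A x)).
Proof.
move=> sA; rewrite /determinant; apply: smooth_sum => s.
by apply: smoothM; [exact: smooth_cst|apply: smooth_prod => i].
Qed.

(** Cramer's rule. The determinant is inverted by a smooth function only near [q], whence the local
    conclusion. *)
Lemma smooth_invmx m q (A : M -> 'M[R]_m) :
  (forall i j, smooth (fun x => A x i j)) -> A q \in unitmx ->
  exists2 B : M -> 'M[R]_m, (forall i j, smooth (fun x => B x i j)) &
    \forall q' \near q, A q' *m B q' = 1%:M.
Proof.
move=> sA; rewrite unitmxE unitfE => dA.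
have [g sg gE] := smooth_inv (smooth_det sA) dA.
exists (fun x => g x *: \adj (A x)).
  move=> i j; rewrite (_ : (fun x => _) =
      fun x => g x * ((-1) ^+ (j + i) * \det (row' j (col' i (A x))))); last first.
    by apply/funext => x; rewrite !mxE.
  apply: smoothM => //; apply: smoothM; first exact: smooth_cst.
  apply: smooth_det => k l; rewrite (_ : (fun x => _) = fun x => A x (lift j k) (lift i l))//.
  by apply/funext => x; rewrite !mxE.
apply: filterS gE => x gx.
by rewrite -scalemxAr mul_mx_adj scale_scalar_mx mulrC gx.
Qed.

Lemma tvec_scaleE (a : R) v f : (a *: v) f = a * v f.
Proof. by []. Qed.

Lemma tvec_sumE (I : finType) (F : I -> tvec M) f :
  (\sum_i F i) f = \sum_i F i f.
Proof. by elim/big_rec2 : _ => // i a b _ <-. Qed.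

Definition cvec c (a : 'rV[R]_n) q : tvec M :=
  fun f => if `[< smooth f >] then 'D_a (f \o cinv c) (cmap c q) else 0.

Lemma tangent_cvec c a q : atlas c -> cdom c q -> tangent q (cvec c a q).
Proof. by move=> ac cq; exists c, a. Qed.

Lemma smooth_chart_differentiable c q f : atlas c -> cdom c q -> smooth f ->
  differentiable (f \o cinv c) (cmap c q).
Proof.
move=> ac cq sf; apply: (Cinf_differentiable (U := cmap c @` cdom c)).
- exact: cimg_open.
- by have := sf c ac; rewrite setIT.
- by exists q.
Qed.

Lemma cvec_sum c a q : atlas c -> cdom c q ->
  cvec c a q = \sum_i a 0 i *: cvec c 'e_i q.
Proof.
move=> ac cq; apply/funext => f; rewrite tvec_sumE /cvec.
under eq_bigr do rewrite tvec_scaleE.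
case: asboolP => sf; last by rewrite big1// => i _; rewrite mulr0.
by apply: derive_sum_coord; exact: smooth_chart_differentiable.
Qed.

Lemma near_chart c q (P : 'rV[R]_n -> Prop) : cdom c q ->
  (\forall q' \near q, P (cmap c q')) -> \forall y \near cmap c q, P y.
Proof.
move=> cq; rewrite /prop_near1 nbhsE => -[W [oW Wq] WP].
have oI : open (cmap c @` (cdom c `&` W)).
  apply: chart_image_open; last by move=> x [].
  by apply: openI => //; exact: cdom_open.
apply: filterS (open_nbhs_nbhs (conj oI _)); last by exists q.
by move=> _ [x [cx Wx] <-]; exact: WP.
Qed.

Lemma near_cdom c q : cdom c q -> \forall q' \near q, cdom c q'.
Proof. by move=> cq; apply: open_nbhs_nbhs; split=> //; exact: cdom_open. Qed.

(** Chain rule through the transition map [tr]. In [tangent] each vector comes with its own chart; a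
    common one is needed to add two vectors. *)
Lemma tangent_chart c q v : atlas c -> cdom c q -> tangent q v ->
  exists a, v = cvec c a q.
Proof.
move=> ac cq [c' [b [ac' cq' vE]]].
pose tr x := cmap c (cinv c' x).
exists (\row_j 'D_b (fun x => tr x 0 j) (cmap c' q)).
rewrite cvec_sum//; apply/funext => f; rewrite vE tvec_sumE.
under eq_bigr do rewrite tvec_scaleE /cvec mxE.
case: asboolP => sf; last by rewrite big1// => i _; rewrite mulr0.
have trE : tr (cmap c' q) = cmap c q by rewrite /tr cmapK.
rewrite (@near_eq_derive _ _ _ _ ((f \o cinv c) \o tr)); last first.
  apply: near_chart => //; apply: filterS2 (near_cdom cq) (near_cdom cq') => x cx cx'.
  by rewrite /tr /= !cmapK.
rewrite derive_comp_coord ?trE//; last exact: smooth_chart_differentiable.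
move=> j; apply: (Cinf_differentiable _ (atlas_compatible ac' ac j)).
- apply: chart_image_open; last by move=> x [].
  by apply: openI; exact: cdom_open.
- by exists q.
Qed.

Lemma cvec_linear c q (k : R) a b : atlas c -> cdom c q ->
  cvec c (k *: a + b) q = k *: cvec c a q + cvec c b q.
Proof.
move=> ac cq; rewrite !(cvec_sum _ ac cq) scaler_sumr -big_split /=.
by apply: eq_bigr => i _; rewrite !mxE scalerDl scalerA.
Qed.

Lemma tangent_linear q (k : R) v w : tangent q v -> tangent q w ->
  tangent q (k *: v + w).
Proof.
move=> tv tw; have [c ac cq] := atlas_cover q.
have [a ->] := tangent_chart ac cq tv; have [b ->] := tangent_chart ac cq tw.
by rewrite -cvec_linear//; exact: tangent_cvec.
Qed.

Lemma tangent0 q : tangent q (0 : tvec M).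
Proof.
have [c ac cq] := atlas_cover q; rewrite (_ : 0 = cvec c 0 q).
  exact: tangent_cvec.
by rewrite cvec_sum// big1// => i _; rewrite mxE scale0r.
Qed.

Lemma tangentZ q (k : R) v : tangent q v -> tangent q (k *: v).
Proof. by move=> tv; rewrite -[_ *: _]addr0; apply: tangent_linear => //; exact: tangent0. Qed.

Lemma tangentD q v w : tangent q v -> tangent q w -> tangent q (v + w).
Proof. by move=> tv tw; rewrite -[v]scale1r; exact: tangent_linear. Qed.

Lemma tangent_sum q (I : finType) (F : I -> tvec M) :
  (forall i, tangent q (F i)) -> tangent q (\sum_i F i).
Proof.
by move=> tF; elim/big_ind : _ => //; [exact: tangent0|move=> x y; exact: tangentD].
Qed.

Lemma tangent_not_smooth q v f : tangent q v -> ~ smooth f -> v f = 0.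
Proof. by move=> [c [a [_ _ ->]]] nsf; case: asboolP. Qed.

Lemma tangent_ext q v w : tangent q v -> tangent q w ->
  (forall f, smooth f -> v f = w f) -> v = w.
Proof.
move=> tv tw vw; apply/funext => f; have [|nsf] := pselect (smooth f); first exact: vw.
by rewrite (tangent_not_smooth tv)// (tangent_not_smooth tw).
Qed.

Lemma tangent_add q v f g : tangent q v -> smooth f -> smooth g ->
  v (fun x => f x + g x) = v f + v g.
Proof.
move=> [c [a [ac cq vE]]] sf sg; rewrite !vE !asboolT//; last exact: smoothD.
by apply: deriveD; apply: diff_derivable; exact: smooth_chart_differentiable.
Qed.

Lemma tangent_mul q v f g : tangent q v -> smooth f -> smooth g ->
  v (fun x => f x * g x) = f q * v g + g q * v f.
Proof.
move=> [c [a [ac cq vE]]] sf sg; rewrite !vE !asboolT//; last exact: smoothM.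
have := deriveM (@diff_derivable _ _ _ _ _ a (smooth_chart_differentiable ac cq sf))
  (@diff_derivable _ _ _ _ _ a (smooth_chart_differentiable ac cq sg)).
by rewrite /= cmapK.
Qed.

Lemma tangent_cst q v (k : R) : tangent q v -> v (cst k) = 0.
Proof.
move=> [c [a [ac cq ->]]]; rewrite asboolT; last exact: smooth_cst.
exact: derive_cst.
Qed.

Lemma tangent_near q v f g : tangent q v -> smooth f -> smooth g ->
  (\forall q' \near q, f q' = g q') -> v f = v g.
Proof.
move=> [c [a [ac cq vE]]] sf sg fg; rewrite !vE !asboolT//.
apply: near_eq_derive; apply: near_chart => //.
by apply: filterS2 fg (near_cdom cq) => x fx cx; rewrite /= cmapK.
Qed.

Lemma tangent_scale q v f (k : R) : tangent q v -> smooth f ->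
  v (fun x => k * f x) = k * v f.
Proof.
move=> tv sf; rewrite (tangent_mul (f := cst k) tv)//; last exact: smooth_cst.
by rewrite (tangent_cst _ tv) mulr0 addr0.
Qed.

Lemma tangent_sub q v f g : tangent q v -> smooth f -> smooth g ->
  v (fun x => f x - g x) = v f - v g.
Proof.
move=> tv sf sg; rewrite (_ : (fun x => _) = (fun x => f x + (-1) * g x)).
  rewrite (tangent_add tv sf (smoothM (smooth_cst (-1)) sg)).
  by rewrite (tangent_scale _ tv sg) mulN1r.
by apply/funext => x; rewrite mulN1r.
Qed.

Lemma tangent_bigsum q v (I : finType) (F : I -> M -> R) : tangent q v ->
  (forall i, smooth (F i)) -> v (fun x => \sum_i F i x) = \sum_i v (F i).
Proof.
move=> tv sF; suff [] : smooth (\sum_i F i) /\ v (\sum_i F i) = \sum_i v (F i).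
  move=> _ <-; congr (v _); by apply/funext => y; rewrite fct_sumE.
elim/big_rec2 : _ => [|i a b _ [sb vb]].
  by split; [exact: smooth_cst|exact: (tangent_cst 0 tv)].
by split; [exact: (smoothD (sF i) sb)|rewrite -vb; exact: (tangent_add tv (sF i) sb)].
Qed.

Lemma smooth_vfP (X : vfield M) : smooth_vf X <->
  (forall q, tangent q (X q)) /\ forall f, smooth f -> smooth (vf_app X f).
Proof. by split=> -[tX sX]; split=> // q *; exact: tX. Qed.

Lemma smooth_vf_tangent (X : vfield M) q : smooth_vf X -> tangent q (X q).
Proof. by move=> /smooth_vfP[]. Qed.

Lemma smooth_vf_app (X : vfield M) f : smooth_vf X -> smooth f -> smooth (vf_app X f).
Proof. by move=> /smooth_vfP[_ sX]; exact: sX. Qed.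

Lemma smooth_vfD (X Y : vfield M) : smooth_vf X -> smooth_vf Y -> smooth_vf (X + Y).
Proof.
move=> /smooth_vfP[tX sX] /smooth_vfP[tY sY]; apply/smooth_vfP; split.
  by move=> q; exact: tangentD.
by move=> f sf; apply: smoothD; [exact: sX|exact: sY].
Qed.

Lemma smooth_vf0 : smooth_vf (0 : vfield M).
Proof.
by apply/smooth_vfP; split; [exact: tangent0|move=> f _; exact: (smooth_cst 0)].
Qed.

Lemma smooth_vf_scale f (X : vfield M) : smooth f -> smooth_vf X ->
  smooth_vf (fscale f X).
Proof.
move=> sf /smooth_vfP[tX sX]; apply/smooth_vfP; split.
  by move=> q; exact: tangentZ.
by move=> h sh; apply: smoothM => //; exact: sX.
Qed.

Lemma fscale_cst (k : R) (X : vfield M) : fscale (cst k) X = k *: X.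
Proof. by []. Qed.

Lemma smooth_vfZ (k : R) (X : vfield M) : smooth_vf X -> smooth_vf (k *: X).
Proof. by rewrite -fscale_cst; apply: smooth_vf_scale; exact: smooth_cst. Qed.

Lemma smooth_vfB (X Y : vfield M) : smooth_vf X -> smooth_vf Y -> smooth_vf (X - Y).
Proof.
by move=> sX sY; rewrite -scaleN1r; apply: smooth_vfD => //; exact: smooth_vfZ.
Qed.

Lemma smooth_vf_sum (I : finType) (F : I -> vfield M) :
  (forall i, smooth_vf (F i)) -> smooth_vf (\sum_i F i).
Proof.
by move=> tF; elim/big_ind : _ => //; [exact: smooth_vf0|move=> x y; exact: smooth_vfD].
Qed.

(** The chart coordinates and coordinate fields are cut off by bump functions to make them global.
    The last clause is the main tool below: near [q], a vector is determined by its values on the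
    [x i]. *)
Lemma local_coordinates q : exists c, exists x : 'I_n -> M -> R, exists D : 'I_n -> vfield M,
  [/\ atlas c /\ cdom c q, forall i, smooth (x i), forall i, smooth_vf (D i) &
      \forall q' \near q, [/\ cdom c q', forall i, D i q' = cvec c 'e_i q',
         forall i j, D i q' (x j) = (i == j)%:R &
         forall v, tangent q' v -> v = \sum_i v (x i) *: D i q']].
Proof.
have [c ac cq] := atlas_cover q.
have oc := cdom_open c.
have [phi [C [sphi phi1 cC CN phi0]]] := smooth_bump (near_cdom cq).
have sx i : smooth_near q (fun y => cmap c y 0 i).
  exists (cdom c); split => //; apply: smooth_on_local => // y cy.
  exists c, (cmap c @` cdom c), (fun z => z 0 i); split=> //.
    by split; [exact: cimg_open|exists y].
  by apply: Cinf_coord; exact: cimg_open.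
have /choice[x xP] : forall i, exists x, smooth x /\
    \forall q' \near q, x q' = cmap c q' 0 i.
  by move=> i; have [x ? ?] := smooth_near_extend (sx i); exists x.
pose D (i : 'I_n) : vfield M := fun y => if `[< cdom c y >] then phi y *: cvec c 'e_i y else 0.
exists c, x, D; split=> //; first by move=> i; have [] := xP i.
  move=> i; apply/smooth_vfP; split.
    move=> y; rewrite /D; case: asboolP => cy; last exact: tangent0.
    by apply: tangentZ; exact: tangent_cvec.
  move=> f sf; apply: smooth_near_smooth => y; rewrite /vf_app /D.
  have [cy|ncy] := pselect (cdom c y); last first.
    apply: (@smooth_near_eq _ _ _ _ (cst 0)); last by apply/smooth_smooth_near/smooth_cst.
    have nCy : (~` C) y by move=> /CN.
    have : nbhs y (~` C) by apply: open_nbhs_nbhs; split => //; exact: closed_openC.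
    by apply: filterS => z /phi0 phiz; case: asboolP => // _; rewrite phiz scale0r.
  apply: (@smooth_near_eq _ _ _ _
    (fun z => phi z * 'D_'e_i (f \o cinv c) (cmap c z))).
    apply: filterS (near_cdom cy) => z cz; rewrite asboolT// tvec_scaleE.
    by rewrite /cvec asboolT.
  apply: smooth_nearM; first exact: smooth_smooth_near.
  exists (cdom c); split => //; apply: smooth_on_local => // z cz.
  exists c, (cmap c @` cdom c), ('D_'e_i (f \o cinv c)); split => //.
    by split; [exact: cimg_open|exists z].
  by apply: Cinf_D; have := sf c ac; rewrite setIT.
have nx : \forall q' \near q, forall i, x i q' = cmap c q' 0 i.
  by have := @filter_forall _ 'I_n (fun i z => x i z = cmap c z 0 i) (nbhs q) _;
    apply => i; have [] := xP i.
(* Applying [D i] to [x j] at [q'] requires [x j] to be the chart coordinate on a neighbourhood of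
   [q'], not just at [q']. *)
have nnx : \forall q' \near q, \forall q'' \near q', forall i, x i q'' = cmap c q'' 0 i.
  exact: nbhs_interior.
apply: filterS3 (near_cdom cq) phi1 nnx => y cy phiy xy.
have Dy i : D i y = cvec c 'e_i y by rewrite /D asboolT// phiy scale1r.
have xE a i : cvec c a y (x i) = a 0 i.
  rewrite /cvec asboolT; last by have [] := xP i.
  rewrite (@near_eq_derive _ _ _ _ (fun z : 'rV[R]_n => z 0 i)) ?derive_coord//.
  apply: near_chart => //; apply: filterS2 xy (near_cdom cy) => z xz cz.
  by rewrite /= cmapK.
split=> // [i j|v tv]; first by rewrite Dy xE mxE eqxx eq_sym.
have [a vE] := tangent_chart ac cy tv.
by rewrite {1}vE cvec_sum//; apply: eq_bigr => i _; rewrite Dy vE xE.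
Qed.

(* In coordinates [D_i], the second order terms cancel by symmetry of second
   partial derivatives. *)
Lemma lie_tangent (X Y : vfield M) q : smooth_vf X -> smooth_vf Y ->
  tangent q (lie X Y q).
Proof.
move=> sX sY; have [c [x [D [[ac cq] sx sD nD]]]] := local_coordinates q.
have tX := smooth_vf_tangent q sX; have tY := smooth_vf_tangent q sY.
have DD i j f : smooth f -> D i q (vf_app (D j) f) = D j q (vf_app (D i) f).
  have key k l : smooth f -> D k q (vf_app (D l) f) =
      'D_'e_k ('D_'e_l (f \o cinv c)) (cmap c q).
    move=> sf; have [_ -> _ _] := nbhs_singleton nD.
    rewrite /cvec asboolT; last exact: smooth_vf_app.
    apply: near_eq_derive; apply: near_chart => //.
    apply: filterS2 nD (near_cdom cq) => y [_ Dy _ _] cy.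
    by rewrite /= cmapK// /vf_app Dy /cvec asboolT.
  move=> sf; have sfc : Cinf (cmap c @` cdom c) (f \o cinv c).
    by have := sf c ac; rewrite setIT.
  have cqi : (cmap c @` cdom c) (cmap c q) by exists q.
  rewrite (key i j sf) (key j i sf).
  exact: (derive_comm i j (@cimg_open _ _ _ c) sfc cqi).
(* Near [q], [Y0 f] is the sum of the products of [Y0 (x i)] and [D i f]; the product rule then
   isolates the second order terms [X0 (D i f)]. *)
have expand (X0 Y0 : vfield M) f : smooth_vf X0 -> smooth_vf Y0 -> smooth f ->
   X0 q (vf_app Y0 f) = \sum_i (Y0 q (x i) * X0 q (vf_app (D i) f) +
      D i q f * X0 q (vf_app Y0 (x i))).
  move=> sX0 sY0 sf; have tX0 := smooth_vf_tangent q sX0.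
  rewrite (@tangent_near _ _ _ (fun y => \sum_i vf_app Y0 (x i) y * vf_app (D i) f y) tX0).
  - rewrite (tangent_bigsum tX0); last by move=> i; apply: smoothM; exact: smooth_vf_app.
    apply: eq_bigr => i _.
    by rewrite (tangent_mul tX0 (smooth_vf_app sY0 (sx i)) (smooth_vf_app (sD i) sf)).
  - exact: smooth_vf_app.
  - by apply: smooth_sum => i; apply: smoothM; exact: smooth_vf_app.
  - apply: filterS nD => y [_ _ _ yE].
    have tY0 := smooth_vf_tangent y sY0.
    by rewrite /vf_app (yE _ tY0) tvec_sumE -(yE _ tY0).
have -> : lie X Y q = \sum_i (X q (vf_app Y (x i)) - Y q (vf_app X (x i))) *: D i q.
  apply/funext => f; rewrite tvec_sumE /lie; have [sf|nsf] := pselect (smooth f).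
    rewrite !expand// -sumrB.
    have [_ _ _ qE] := nbhs_singleton nD.
    have XD i : X q (vf_app (D i) f) = \sum_j X q (x j) * D j q (vf_app (D i) f).
      by rewrite [in LHS](qE _ tX) tvec_sumE.
    have YD i : Y q (vf_app (D i) f) = \sum_j Y q (x j) * D j q (vf_app (D i) f).
      by rewrite [in LHS](qE _ tY) tvec_sumE.
    have sym : \sum_i Y q (x i) * X q (vf_app (D i) f) =
               \sum_i X q (x i) * Y q (vf_app (D i) f).
      under eq_bigr do rewrite XD mulr_sumr.
      rewrite exchange_big /=; apply: eq_bigr => i _.
      rewrite YD mulr_sumr; apply: eq_bigr => j _.
      by rewrite mulrCA (DD _ _ _ sf).
    rewrite sumrB !big_split /= sym opprD addrACA subrr add0r.
    rewrite -sumrB; apply: eq_bigr => i _; rewrite tvec_scaleE; ring.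
  (* Tangent vectors return 0 on a function that is not smooth, so both sides vanish. *)
  have z (Z : vfield M) : smooth_vf Z -> vf_app Z f = cst 0.
    move=> sZ; apply/funext => y.
    by rewrite /vf_app (tangent_not_smooth (smooth_vf_tangent y sZ) nsf).
  rewrite !z// (tangent_cst _ tX) (tangent_cst _ tY) subr0 big1// => i _.
  by rewrite tvec_scaleE (tangent_not_smooth (smooth_vf_tangent q (sD i)) nsf) mulr0.
by apply: tangent_sum => i; apply: tangentZ; exact: smooth_vf_tangent.
Qed.

Lemma smooth_vf_lie (X Y : vfield M) : smooth_vf X -> smooth_vf Y -> smooth_vf (lie X Y).
Proof.
move=> sX sY; apply/smooth_vfP; split; first by move=> q; exact: lie_tangent.
move=> f sf; rewrite (_ : vf_app _ _ =
    fun y => vf_app X (vf_app Y f) y + (-1) * vf_app Y (vf_app X f) y).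
  apply: smoothD; first by do 2 apply: smooth_vf_app => //.
  apply: smoothM; first exact: smooth_cst.
  by do 2 apply: smooth_vf_app => //.
by apply/funext => y; rewrite mulN1r.
Qed.

Lemma extend_tangent q v : tangent q v -> exists2 A : vfield M, smooth_vf A & A q = v.
Proof.
move=> tv; have [c [x [D [[ac cq] sx sD nD]]]] := local_coordinates q.
exists (\sum_i v (x i) *: D i).
  by apply: smooth_vf_sum => i; exact: smooth_vfZ.
have [_ _ _ /(_ _ tv) vE] := nbhs_singleton nD; rewrite [RHS]vE.
by rewrite fct_sumE.
Qed.

Definition Cinf_linear q (F : vfield M -> tvec M) := forall f (X Y : vfield M),
  smooth f -> smooth_vf X -> smooth_vf Y -> F (fscale f X + Y) = f q *: F X + F Y.

Lemma Cinf_linear_sum q (F : vfield M -> tvec M) (I : finType) (f : I -> M -> R)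
    (X : I -> vfield M) : Cinf_linear q F ->
  (forall i, smooth (f i)) -> (forall i, smooth_vf (X i)) ->
  F (\sum_i fscale (f i) (X i)) = \sum_i f i q *: F (X i).
Proof.
move=> FL sf sX; suff [] : smooth_vf (\sum_i fscale (f i) (X i)) /\
   F (\sum_i fscale (f i) (X i)) = \sum_i f i q *: F (X i) by [].
elim/big_rec2 : _ => [|i a b _ [sb <-]].
  split; first exact: smooth_vf0.
  (* This instance reads [F 0 = F 0 + F 0]. *)
  have := FL (cst 1) 0 0 (smooth_cst 1) smooth_vf0 smooth_vf0.
  rewrite fscale_cst scale1r addr0 /= scale1r => /eqP.
  by rewrite -subr_eq0 opprD addrA subrr sub0r oppr_eq0 => /eqP.
by rewrite FL//; split=> //; apply: smooth_vfD => //; exact: smooth_vf_scale.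
Qed.

(** Let [B] vanish at [q], and let [phi] be a bump function with [phi q = 1], supported where
    coordinates are available. Then [F B = F (phi B)], and [phi B] is a global combination of the
    [D i] whose coefficients vanish at [q]. *)
Lemma tensorial q (F : vfield M -> tvec M) (A A' : vfield M) : Cinf_linear q F ->
  smooth_vf A -> smooth_vf A' -> A q = A' q -> F A = F A'.
Proof.
move=> FL sA sA' AA'.
have FZ f X : smooth f -> smooth_vf X -> F (fscale f X) = f q *: F X.
  move=> sf sX; have := @Cinf_linear_sum q F 'I_1 (fun=> f) (fun=> X) FL.
  by rewrite !big_ord1; apply.
have F_0 B : smooth_vf B -> B q = 0 -> F B = 0.
  move=> sB Bq; have [c [x [D [[ac cq] sx sD nD]]]] := local_coordinates q.
  have [phi [C [sphi phi1 cC CN phi0]]] := smooth_bump nD.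
  have phiq : phi q = 1 := nbhs_singleton phi1.
  have -> : F B = F (fscale phi B) by rewrite FZ// phiq scale1r.
  have -> : fscale phi B = \sum_i fscale (fun y => phi y * B y (x i)) (D i).
    apply/funext => y; rewrite fct_sumE /fscale.
    have [/CN[_ _ _ yE]|/phi0 ->] := pselect (C y).
      rewrite [in LHS](yE _ (smooth_vf_tangent y sB)) scaler_sumr.
      by apply: eq_bigr => i _; rewrite scalerA.
    by rewrite scale0r big1// => i _; rewrite mul0r scale0r.
  rewrite (Cinf_linear_sum FL)//; last by move=> i; apply: smoothM => //; exact: smooth_vf_app.
  by rewrite big1// => i _; rewrite Bq [X in _ * X](_ : _ = 0)// mulr0 scale0r.
have : F (A - A') = 0 by apply: F_0; [exact: smooth_vfB|rewrite -[LHS]/(A q - A' q) AA' subrr].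
have -> : F (A - A') = F A - F A'.
  rewrite addrC -scaleN1r -fscale_cst FL//; last exact: smooth_cst.
  by rewrite scaleN1r addrC.
by move/eqP; rewrite subr_eq0 => /eqP.
Qed.

Lemma tensor_coord q (F : vfield M -> tvec M) (x : 'I_n -> M -> R)
    (D : 'I_n -> vfield M) (A : vfield M) : Cinf_linear q F -> smooth_vf A ->
  (forall i, smooth_vf (D i)) ->
  (forall v, tangent q v -> v = \sum_i v (x i) *: D i q) ->
  F A = \sum_i A q (x i) *: F (D i).
Proof.
move=> FL sA sD qE; have sc i : smooth (cst (A q (x i)) : M -> R) by exact: smooth_cst.
rewrite -(Cinf_linear_sum FL sc sD); apply: (tensorial FL) => //.
  by apply: smooth_vf_sum => i; exact: smooth_vf_scale.
rewrite fct_sumE; exact: (qE _ (smooth_vf_tangent q sA)).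
Qed.

End TangentVectors.

(** * Lie brackets and horizontal projection *)

Section Brackets.
Context {R : realType} {n : nat} {M : manifold R n}.
Implicit Types (q : M) (f : M -> R) (X Y Z : vfield M).

Lemma vf_ext X Y : smooth_vf X -> smooth_vf Y ->
  (forall q f, smooth f -> X q f = Y q f) -> X = Y.
Proof.
move=> sX sY XY; apply/funext => q.
by apply: (tangent_ext (smooth_vf_tangent q sX) (smooth_vf_tangent q sY)) => f; exact: XY.
Qed.

Lemma lie_linearr Z (k : R) X Y : smooth_vf Z -> smooth_vf X -> smooth_vf Y ->
  lie Z (k *: X + Y) = k *: lie Z X + lie Z Y.
Proof.
move=> sZ sX sY; apply: vf_ext => [||q f sf].
- by apply: smooth_vf_lie => //; apply: smooth_vfD => //; exact: smooth_vfZ.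
- by apply: smooth_vfD; [apply: smooth_vfZ|]; exact: smooth_vf_lie.
have tZ := smooth_vf_tangent q sZ.
have sXf := smooth_vf_app sX sf; have sYf := smooth_vf_app sY sf.
rewrite -[RHS]/(k * lie Z X q f + lie Z Y q f) /lie.
rewrite -[vf_app (k *: X + Y) f]/(fun x => k * vf_app X f x + vf_app Y f x).
rewrite (tangent_add tZ (smoothM (smooth_cst k) sXf) sYf) (tangent_scale _ tZ sXf).
rewrite -[(k *: X + Y) q _]/(k * X q (vf_app Z f) + Y q (vf_app Z f)); ring.
Qed.

Lemma lieC X Y : lie X Y = - lie Y X.
Proof.
by apply/funext => q; apply/funext => f; rewrite -[RHS]/(- lie Y X q f) /lie opprB.
Qed.

Lemma lie_linearl Z (k : R) X Y : smooth_vf Z -> smooth_vf X -> smooth_vf Y ->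
  lie (k *: X + Y) Z = k *: lie X Z + lie Y Z.
Proof.
by move=> sZ sX sY; rewrite lieC lie_linearr// opprD -scalerN -!lieC.
Qed.

Lemma lieD Z X Y : smooth_vf Z -> smooth_vf X -> smooth_vf Y ->
  lie Z (X + Y) = lie Z X + lie Z Y.
Proof. by move=> *; rewrite -[X]scale1r lie_linearr// !scale1r. Qed.

Lemma lieB Z X Y : smooth_vf Z -> smooth_vf X -> smooth_vf Y ->
  lie Z (X - Y) = lie Z X - lie Z Y.
Proof. by move=> *; rewrite addrC -scaleN1r lie_linearr// scaleN1r addrC. Qed.

Lemma lie_fscale Z f X : smooth_vf Z -> smooth f -> smooth_vf X ->
  lie Z (fscale f X) = fscale f (lie Z X) + fscale (vf_app Z f) X.
Proof.
move=> sZ sf sX; apply: vf_ext => [||q h sh].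
- by apply: smooth_vf_lie => //; exact: smooth_vf_scale.
- apply: smooth_vfD; apply: smooth_vf_scale => //; first exact: smooth_vf_lie.
  exact: smooth_vf_app.
have tZ := smooth_vf_tangent q sZ.
rewrite -[RHS]/(f q * lie Z X q h + Z q f * X q h) /lie.
rewrite -[vf_app (fscale f X) h]/(fun x => f x * vf_app X h x).
rewrite (tangent_mul tZ sf (smooth_vf_app sX sh)).
rewrite -[fscale f X q _]/(f q * X q (vf_app Z h)) /vf_app; ring.
Qed.

Lemma jacobi X Y Z : smooth_vf X -> smooth_vf Y -> smooth_vf Z ->
  lie X (lie Y Z) = lie (lie X Y) Z + lie Y (lie X Z).
Proof.
move=> sX sY sZ; apply: vf_ext => [||q f sf].
- by do 2 apply: smooth_vf_lie => //.
- by apply: smooth_vfD; do 2 apply: smooth_vf_lie => //.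
have key (A B C : vfield M) : smooth_vf A -> smooth_vf B -> smooth_vf C ->
    lie A (lie B C) q f = A q (vf_app B (vf_app C f)) - A q (vf_app C (vf_app B f)) -
     (B q (vf_app C (vf_app A f)) - C q (vf_app B (vf_app A f))).
  move=> sA sB sC; rewrite {1}/lie.
  rewrite -[vf_app (lie B C) f]/(fun x => vf_app B (vf_app C f) x - vf_app C (vf_app B f) x).
  rewrite (tangent_sub (smooth_vf_tangent q sA))//;
    by apply: smooth_vf_app => //; exact: smooth_vf_app.
rewrite -[RHS]/(lie (lie X Y) Z q f + lie Y (lie X Z) q f).
rewrite (lieC (lie X Y)) -[(- lie _ _) q f]/(- lie Z (lie X Y) q f).
rewrite !key//; ring.
Qed.

End Brackets.

Section Subbundles.
Context {R : realType} {n : nat} {M : manifold R n}.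
Implicit Types (q : M) (f : M -> R) (X Y Z : vfield M) (E : subbundle M).

(** The linear structure of the fibers is read off from a local frame. *)
Lemma fiber_linear E q (k : R) v w : E q v -> E q w -> E q (k *: v + w).
Proof.
have [W [X [[oW Wq] sX EX _]]] := local_frame E q.
move=> /(EX _ _ Wq)[a ->] /(EX _ _ Wq)[b ->]; apply/(EX _ _ Wq).
exists (k *: a + b); rewrite scaler_sumr -big_split /=; apply: eq_bigr => i _.
by rewrite !mxE scalerDl scalerA.
Qed.

Lemma fiber0 E q : E q (0 : tvec M).
Proof.
have [W [X [[oW Wq] sX EX _]]] := local_frame E q.
by apply/(EX _ _ Wq); exists 0; rewrite big1// => i _; rewrite mxE scale0r.
Qed.

Lemma fiberZ E q (k : R) v : E q v -> E q (k *: v).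
Proof. by move=> Ev; rewrite -[_ *: _]addr0; apply: fiber_linear => //; exact: fiber0. Qed.

Lemma fiberD E q v w : E q v -> E q w -> E q (v + w).
Proof. by move=> Ev; rewrite -[v]scale1r; exact: fiber_linear. Qed.

Lemma fiberN E q v : E q v -> E q (- v).
Proof. by rewrite -scaleN1r; exact: fiberZ. Qed.

Lemma fiberB E q v w : E q v -> E q w -> E q (v - w).
Proof. by move=> Ev /fiberN; exact: fiberD. Qed.

Lemma section_linear E (k : R) X Y :
  is_section E X -> is_section E Y -> is_section E (k *: X + Y).
Proof.
move=> [sX EX] [sY EY]; split; first by apply: smooth_vfD => //; exact: smooth_vfZ.
by move=> q; exact: fiber_linear.
Qed.

Lemma sectionB E X Y : is_section E X -> is_section E Y -> is_section E (X - Y).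
Proof. by move=> sX sY; rewrite addrC -scaleN1r; exact: section_linear. Qed.

End Subbundles.

Section HorizontalProjection.
Context {R : realType} {n : nat} {M : manifold R n} (S : sRC M).
Implicit Types (q : M) (f : M -> R) (X Y Z : vfield M) (v w : tvec M).

(* [hproj X q] depends on [X q] only: [hproj X q = hpr q (X q)] by conversion. *)
Definition hpr q v : tvec M := xget 0 [set h | HM S q h /\ VM S q (v - h)].

Lemma hprP q v : tangent q v -> HM S q (hpr q v) /\ VM S q (v - hpr q v).
Proof.
move=> tv; have [h [hP _]] := HM_VM_direct S tv; rewrite /hpr.
exact: (xgetPex 0 (ex_intro (fun h => HM S q h /\ VM S q (v - h)) h hP)).
Qed.

Lemma hpr_unique q v h : tangent q v -> HM S q h -> VM S q (v - h) -> hpr q v = h.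
Proof.
move=> tv Hh Vh; have [h' [_ U]] := HM_VM_direct S tv.
by rewrite -(U _ (hprP tv)) -(U _ (conj Hh Vh)).
Qed.

Lemma hpr_linear q (k : R) v w : tangent q v -> tangent q w ->
  hpr q (k *: v + w) = k *: hpr q v + hpr q w.
Proof.
move=> tv tw; have [Hv Vv] := hprP tv; have [Hw Vw] := hprP tw.
apply: hpr_unique; [exact: tangent_linear|exact: fiber_linear|].
by rewrite opprD addrACA -scalerBr; exact: fiber_linear.
Qed.

Lemma hpr_H q v : HM S q v -> hpr q v = v.
Proof.
move=> Hv; apply: hpr_unique => //; first exact: fiber_tangent Hv.
by rewrite subrr; exact: fiber0.
Qed.

Lemma hpr_V q v : VM S q v -> hpr q v = 0.
Proof.
move=> Vv; apply: hpr_unique; [exact: fiber_tangent Vv|exact: fiber0|].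
by rewrite subr0.
Qed.

Lemma HV_eq0 q v : HM S q v -> VM S q v -> v = 0.
Proof. by move=> Hv Vv; rewrite -(hpr_H Hv) hpr_V. Qed.

(** Over the reals, [u *m Z *m Z^T = 0] gives [|u *m Z|^2 = 0]. The Gram matrix provides a right
    inverse of a matrix that is not known to be square, so the ranks of [HM] and [VM] are never
    compared with [n]. *)
Lemma gram_unit r m (Z : 'M[R]_(r, m)) :
  (forall u : 'rV_r, u *m Z = 0 -> u = 0) -> Z *m Z^T \in unitmx.
Proof.
move=> Zfree; rewrite -row_free_unit -kermx_eq0; apply/rowV0P => u.
move=> /sub_kermxP uZZ; apply: Zfree.
have H : (u *m Z) *m (u *m Z)^T = 0.
  by rewrite trmx_mul -mulmxA [Z *m _]mulmxA (mulmxA u) uZZ mul0mx.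
apply/rowP => i; move/matrixP: H => /(_ 0 0); rewrite !mxE => /eqP.
rewrite psumr_eq0; last by move=> j _; rewrite [_^T _ _]mxE -expr2 sqr_ge0.
by move=> /allP/(_ i (mem_index_enum _)) /=; rewrite [_^T _ _]mxE mulf_eq0 orbb [in X in X -> _]mxE => /eqP.
Qed.

(* Around a point, the components of a vector field in a joint frame [F] of
   [HM S] and [VM S] are obtained from its coordinates with the inverse of the
   Gram matrix [Z *m Z^T] of the coordinates of [F]. *)
Lemma smooth_hproj X : smooth_vf X -> smooth_vf (hproj S X).
Proof.
move=> sX; apply/smooth_vfP; split.
  move=> q; have [Hq _] := hprP (smooth_vf_tangent q sX).
  exact: fiber_tangent Hq.
move=> f sf; apply: smooth_near_smooth => q.
have [c [x [D [[ac cq] sx sD nD]]]] := local_coordinates q.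
have [W1 [F1 [[oW1 Wq1] sF1 EF1 free1]]] := local_frame (HM S) q.
have [W2 [F2 [[oW2 Wq2] sF2 EF2 free2]]] := local_frame (VM S) q.
set r := rank (HM S) in F1 sF1 EF1 free1; set s := rank (VM S) in F2 sF2 EF2 free2.
pose F (k : 'I_(r + s)) : vfield M :=
  match fintype.split k with inl i => F1 i | inr i => F2 i end.
have FL i : F (lshift s i) = F1 i by rewrite /F (unsplitK (inl i)).
have FR i : F (rshift r i) = F2 i by rewrite /F (unsplitK (inr i)).
have sF k h : smooth h -> smooth_near q (fun y => F k y h).
  rewrite /F => sh; case: (fintype.split k) => i; [exists W1|exists W2]; split => //.
    by have [_ sFi] := sF1 i; exact: sFi.
  by have [_ sFi] := sF2 i; exact: sFi.
have /choice[z0 z0P] : forall ki : 'I_(r + s) * 'I_n, exists z, smooth z /\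
    \forall y \near q, z y = F ki.1 y (x ki.2).
  by move=> [k i]; have [z sz zE] := smooth_near_extend (sF k _ (sx i)); exists z.
pose Z y := \matrix_(k < r + s, i < n) z0 (k, i) y.
have nZ : \forall y \near q, forall k i, Z y k i = F k y (x i).
  have : \forall y \near q, forall ki, z0 ki y = F ki.1 y (x ki.2).
    have := @filter_forall _ ('I_(r + s) * 'I_n)%type
      (fun ki y => z0 ki y = F ki.1 y (x ki.2)) (nbhs q) _.
    by apply => ki; have [] := z0P ki.
  by apply: filterS => y yE k i; rewrite mxE yE.
have sumF y (a : 'rV_(r + s)) : \sum_k a 0 k *: F k y =
   \sum_i (lsubmx a) 0 i *: F1 i y + \sum_i (rsubmx a) 0 i *: F2 i y.
  rewrite big_split_ord /=; congr (_ + _); apply: eq_bigr => i _.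
    by rewrite FL mxE.
  by rewrite FR mxE.
have tF y k : W1 y -> W2 y -> tangent y (F k y).
  rewrite /F => Wy1 Wy2; case: (fintype.split k) => i.
    by have [tFi _] := sF1 i; exact: tFi.
  by have [tFi _] := sF2 i; exact: tFi.
have HF y (a : 'rV_r) : W1 y -> HM S y (\sum_i a 0 i *: F1 i y).
  by move=> Wy; apply/(EF1 _ _ Wy); exists a.
have VF y (a : 'rV_s) : W2 y -> VM S y (\sum_i a 0 i *: F2 i y).
  by move=> Wy; apply/(EF2 _ _ Wy); exists a.
have Zmul y (a : 'rV_(r + s)) : (forall k i, Z y k i = F k y (x i)) ->
    forall i, (a *m Z y) 0 i = (\sum_k a 0 k *: F k y) (x i).
  move=> yE i; rewrite mxE tvec_sumE; apply: eq_bigr => k _.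
  by rewrite yE tvec_scaleE.
(* A vanishing combination splits into a horizontal and a vertical part that are opposite, hence
   both zero. *)
have Zfree (u : 'rV_(r + s)) : u *m Z q = 0 -> u = 0.
  move=> uZ; have [_ _ _ qE] := nbhs_singleton nD.
  have w0 : \sum_k u 0 k *: F k q = 0.
    rewrite [LHS]qE; last first.
      by apply: tangent_sum => k; apply: tangentZ; exact: tF.
    apply: big1 => i _; rewrite -(Zmul q u (nbhs_singleton nZ)) uZ mxE scale0r//.
  rewrite sumF in w0.
  have H0 : \sum_i (lsubmx u) 0 i *: F1 i q = 0.
    apply: (@HV_eq0 q); first exact: HF.
    have -> : \sum_i (lsubmx u) 0 i *: F1 i q = - \sum_i (rsubmx u) 0 i *: F2 i q.
      by apply/eqP; rewrite -addr_eq0 w0.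
    by apply: fiberN; exact: VF.
  have V0 : \sum_i (rsubmx u) 0 i *: F2 i q = 0 by rewrite H0 add0r in w0.
  by rewrite -[u]hsubmxK (free1 _ _ Wq1 H0) (free2 _ _ Wq2 V0) row_mx0.
have sZ k i : smooth (fun y => Z y k i).
  rewrite (_ : (fun y => _) = z0 (k, i)); first by have [] := z0P (k, i).
  by apply/funext => y; rewrite mxE.
have sG i j : smooth (fun y => (Z y *m (Z y)^T) i j).
  rewrite (_ : (fun y => _) = fun y => \sum_k Z y i k * Z y j k); last first.
    by apply/funext => y; rewrite mxE; apply: eq_bigr => k _; rewrite [_^T _ _]mxE.
  by apply: smooth_sum => k; apply: smoothM; exact: sZ.
have [B sB nB] := smooth_invmx sG (gram_unit Zfree).
pose al y : 'rV_n := \row_i X y (x i).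
(* If [a] are the components of [X] in the frame [F], then [al y = a *m Z y]; the right inverse
   [Z^T *m B] recovers [a]. *)
pose co y := al y *m (Z y)^T *m B y.
have sco i : smooth (fun y => co y 0 i).
  rewrite (_ : (fun y => _) = fun y => \sum_j (\sum_k X y (x k) * Z y j k) * B y j i).
    apply: smooth_sum => j; apply: smoothM => //; apply: smooth_sum => k.
    by apply: smoothM => //; exact: (smooth_vf_app sX (sx k)).
  apply/funext => y; rewrite mxE; apply: eq_bigr => j _; congr (_ * _).
  by rewrite mxE; apply: eq_bigr => k _; rewrite [_^T _ _]mxE [al y _ _]mxE.
have nW1 : nbhs q W1 by exact: open_nbhs_nbhs.
have nW2 : nbhs q W2 by exact: open_nbhs_nbhs.
have nW : \forall y \near q, W1 y /\ W2 y by apply: filterS2 nW1 nW2 => y; split.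
apply: (@smooth_near_eq _ _ _ _ (fun y => \sum_(i < r) co y 0 (lshift s i) * F1 i y f)).
  apply: filterS3 nZ nB nW => y yE yB [Wy1 Wy2].
  have tX := smooth_vf_tangent y sX.
  have [/(EF1 _ _ Wy1)[a aE] /(EF2 _ _ Wy2)[b bE]] := hprP tX.
  have XE : X y = \sum_k (row_mx a b) 0 k *: F k y.
    by rewrite sumF row_mxKl row_mxKr -aE -bE addrC subrK.
  have coE : co y = row_mx a b.
    rewrite /co; have -> : al y = row_mx a b *m Z y.
      by apply/rowP => i; rewrite Zmul// -XE mxE.
    by rewrite -!mulmxA (mulmxA (Z y)) yB mulmx1.
  rewrite coE /vf_app -[hproj S X y]/(hpr y (X y)) aE tvec_sumE.
  by apply: eq_bigr => i _; rewrite tvec_scaleE row_mxEl.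
have H (i : 'I_r) : smooth_near q (fun y => co y 0 (lshift s i) * F1 i y f).
  apply: smooth_nearM; first exact: smooth_smooth_near.
  by rewrite -FL; exact: sF.
have sumH (P : {pred 'I_r}) : smooth_near q (\sum_(i | P i) (fun y => co y 0 (lshift s i) * F1 i y f)).
  elim/big_ind : _ => //; first by apply: smooth_smooth_near; exact: (smooth_cst 0).
  by move=> a b; exact: smooth_nearD.
by move: (sumH xpredT); congr smooth_near; apply/funext => y; rewrite fct_sumE.
Qed.

Lemma section_hproj X : smooth_vf X -> is_section (HM S) (hproj S X).
Proof.
move=> sX; split; first exact: smooth_hproj.
by move=> q; have [] := hprP (smooth_vf_tangent q sX).
Qed.

Lemma section_vproj X : smooth_vf X -> is_section (VM S) (X - hproj S X).
Proof.
move=> sX; split; first by apply: smooth_vfB => //; exact: smooth_hproj.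
by move=> q; have [] := hprP (smooth_vf_tangent q sX).
Qed.

Lemma extend_horizontal q v : HM S q v ->
  exists2 X, is_section (HM S) X & X q = v.
Proof.
move=> Hv; have [A sA Aq] := extend_tangent (fiber_tangent Hv).
exists (hproj S A); first exact: section_hproj.
by rewrite -[LHS]/(hpr q (A q)) Aq hpr_H.
Qed.

End HorizontalProjection.

(** * Canonical connection and Killing fields *)

Section CanonicalConnection.
Context {R : realType} {n : nat} {M : manifold R n} (S : sRC M).
Context (g : M -> tvec M -> tvec M -> R) (nabla : vfield M -> vfield M -> vfield M).
Hypothesis ext : metric_extension S g.
Hypothesis can : canonical_connection S g nabla.
Implicit Types (q : M) (f : M -> R) (X Y Z K L A : vfield M) (u v w : tvec M).

Let conn := canon_connection can.
Let hinnerS := hinnerP S.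

Lemma nabla_smooth X Y : smooth_vf X -> smooth_vf Y -> smooth_vf (nabla X Y).
Proof. exact: conn_smooth. Qed.

Lemma nabla_Zr (k : R) X Y : smooth_vf X -> smooth_vf Y ->
  nabla X (k *: Y) = k *: nabla X Y.
Proof.
move=> sX sY; rewrite -fscale_cst (conn_leibniz conn (smooth_cst k) sX sY) fscale_cst.
rewrite [X in _ + X](_ : _ = 0) ?addr0//; apply/funext => q.
by rewrite /fscale /vf_app (tangent_cst _ (smooth_vf_tangent q sX)) scale0r.
Qed.

Lemma nabla_Br X Y Y' : smooth_vf X -> smooth_vf Y -> smooth_vf Y' ->
  nabla X (Y - Y') = nabla X Y - nabla X Y'.
Proof.
move=> sX sY sY'; rewrite -scaleN1r (conn_additiver conn)//; last exact: smooth_vfZ.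
by rewrite nabla_Zr// scaleN1r.
Qed.

Lemma nabla_Cinf_linear q Y : smooth_vf Y -> Cinf_linear q (fun A => nabla A Y q).
Proof. by move=> sY f X X' sf sX sX'; rewrite (conn_linearl conn sf sX sX' sY). Qed.

(* The Leibniz terms of the two operators cancel, so that
   [A |-> nabla X A - [X, A]] is a tensor. *)
Definition ndiff X A := nabla X A - lie X A.

Lemma ndiff_smooth X A : smooth_vf X -> smooth_vf A -> smooth_vf (ndiff X A).
Proof.
move=> sX sA; apply: smooth_vfB; first exact: nabla_smooth.
exact: smooth_vf_lie.
Qed.

Lemma ndiff_linear X f A A' : smooth_vf X -> smooth f -> smooth_vf A -> smooth_vf A' ->
  ndiff X (fscale f A + A') = fscale f (ndiff X A) + ndiff X A'.
Proof.
move=> sX sf sA sA'; have sfA := smooth_vf_scale sf sA.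
rewrite /ndiff (conn_additiver conn)// lieD// (conn_leibniz conn sf)// lie_fscale//.
rewrite [in LHS]opprD addrACA; congr (_ + _).
rewrite opprD addrACA subrr addr0; apply/funext => q.
by rewrite /fscale -[RHS]/(f q *: (nabla X A q - lie X A q)) scalerBr.
Qed.

Lemma ndiff_Cinf_linear q X : smooth_vf X -> Cinf_linear q (fun A => ndiff X A q).
Proof. by move=> sX f A A' sf sA sA'; rewrite ndiff_linear. Qed.

Lemma H_Killing_smooth K : H_Killing S K -> smooth_vf K.
Proof. by case. Qed.

(** Since [HM] and [VM] are parallel, the horizontal part of [nabla A K] is [nabla A (hproj S K)];
    it cancels against the same term of the torsion. *)
Lemma BKE K A : smooth_vf K -> smooth_vf A ->
  BK S nabla K A = hproj S (ndiff K A).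
Proof.
move=> sK sA; apply/funext => q.
have sH := section_hproj S sK; have sV := section_vproj S sK.
have [sNH HNH] := canon_HM_parallel can sA sH.
have [sNV VNV] := canon_VM_parallel can sA sV.
have NK : nabla A K = nabla A (hproj S K) + nabla A (K - hproj S K).
  rewrite -(conn_additiver conn)//; [|exact: sH.1|exact: sV.1].
  by rewrite addrC subrK.
rewrite /BK -[LHS]/(nabla A (hproj S K) q + hpr S q (torsion nabla K A q)).
have -> : torsion nabla K A q =
    (-1) *: (nabla A (hproj S K) q) + ((-1) *: nabla A (K - hproj S K) q + ndiff K A q).
  apply/funext => f; rewrite -[LHS]/(nabla K A q f - nabla A K q f - lie K A q f) NK.
  rewrite -[(_ + _) q f]/(nabla A (hproj S K) q f + nabla A (K - hproj S K) q f).
  rewrite -[RHS]/(-1 * nabla A (hproj S K) q f + (-1 * nabla A (K - hproj S K) q f +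
    (nabla K A q f - lie K A q f))).
  ring.
have tH := smooth_vf_tangent q sNH; have tV := smooth_vf_tangent q sNV.
have tD := smooth_vf_tangent q (ndiff_smooth sK sA).
rewrite hpr_linear//; last by exact: tangent_linear.
rewrite hpr_linear// (hpr_H (HNH q)) (hpr_V (VNV q)) scaler0 add0r.
by rewrite addrA scaleN1r subrr add0r.
Qed.

Lemma BK_smooth K A : smooth_vf K -> smooth_vf A -> is_section (HM S) (BK S nabla K A).
Proof.
by move=> sK sA; rewrite BKE//; apply: section_hproj; exact: ndiff_smooth.
Qed.

Lemma BK_Cinf_linear q K : smooth_vf K -> Cinf_linear q (fun A => BK S nabla K A q).
Proof.
move=> sK f A A' sf sA sA'; have sfA := smooth_vf_scale sf sA.
have tA := smooth_vf_tangent q (ndiff_smooth sK sA).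
have tA' := smooth_vf_tangent q (ndiff_smooth sK sA').
rewrite !BKE//; last exact: smooth_vfD.
by rewrite ndiff_linear// -[LHS]/(hpr S q (f q *: ndiff K A q + ndiff K A' q)) hpr_linear.
Qed.

Lemma BK_horizontal K Y : H_Killing S K -> is_section (HM S) Y ->
  BK S nabla K Y = ndiff K Y.
Proof.
move=> kK sY; have sK := H_Killing_smooth kK; have [_ kH _ _] := kK.
have [_ H] := sectionB (canon_HM_parallel can sK sY) (kH _ sY).
rewrite BKE//; last exact: sY.1.
by apply/funext => q; rewrite -[LHS]/(hpr S q (ndiff K Y q)) hpr_H//; exact: H.
Qed.

Lemma extendP q v : tangent q v -> smooth_vf (extend q v) /\ extend q v q = v.
Proof.
move=> tv; have [A sA Aq] := extend_tangent tv.
rewrite /extend; case: xgetP => [B _ [sB Bq]|H]; first by split.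
by case: (H A).
Qed.

(** By tensoriality, the choice of extension made in [BK_at] is immaterial. *)
Lemma BK_atE q K A : smooth_vf K -> smooth_vf A -> HM S q (A q) ->
  BK_at S nabla K q (A q) = BK S nabla K A q.
Proof.
move=> sK sA HA; rewrite /BK_at asboolT//.
have [sE Eq] := extendP (fiber_tangent HA).
exact: (tensorial (BK_Cinf_linear _ sK)).
Qed.

Lemma hinner_subl q u v w : HM S q u -> HM S q v -> HM S q w ->
  hinner S q (v - w) u = hinner S q v u - hinner S q w u.
Proof.
by move=> Hu Hv Hw; rewrite addrC -scaleN1r (inner_linear hinnerS)// mulN1r addrC.
Qed.

Lemma hinner_subr q u v w : HM S q u -> HM S q v -> HM S q w ->
  hinner S q u (v - w) = hinner S q u v - hinner S q u w.
Proof.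
move=> Hu Hv Hw; rewrite !(inner_sym hinnerS Hu)//; last exact: fiberB.
exact: hinner_subl.
Qed.

Lemma nabla_metric A X Y : smooth_vf A -> is_section (HM S) X -> is_section (HM S) Y ->
  forall q, A q (vf_inner (hinner S) X Y) =
   hinner S q (nabla A X q) (Y q) + hinner S q (X q) (nabla A Y q).
Proof.
move=> sA sX sY q.
have gE X0 Y0 : is_section (HM S) X0 -> is_section (HM S) Y0 ->
    vf_inner (hinner S) X0 Y0 = vf_inner g X0 Y0.
  by move=> [_ H1] [_ H2]; apply/funext => y; rewrite /vf_inner (ext_hinner ext).
rewrite gE// -[LHS]/(vf_app A (vf_inner g X Y) q) (canon_metric can sA sX.1 sY.1).
by rewrite -!gE//; exact: (canon_HM_parallel can).
Qed.

Lemma Killing_metric K X Y : H_Killing S K -> is_section (HM S) X -> is_section (HM S) Y ->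
  forall q, K q (vf_inner (hinner S) X Y) =
   hinner S q (lie K X q) (Y q) + hinner S q (X q) (lie K Y q).
Proof.
by move=> [_ _ _ kM] sX sY q; rewrite -[LHS]/(vf_app K _ q) kM.
Qed.

(** [nabla K] and [lie K] both satisfy the product rule for the inner product, so their difference
    is skew. *)
Lemma BK_skew q K X Y : H_Killing S K -> is_section (HM S) X -> is_section (HM S) Y ->
  hinner S q (BK S nabla K X q) (Y q) = - hinner S q (X q) (BK S nabla K Y q).
Proof.
move=> kK sX sY; have sK := H_Killing_smooth kK; have [_ kH _ _] := kK.
rewrite !BK_horizontal//.
rewrite -[ndiff K X q]/(nabla K X q - lie K X q) -[ndiff K Y q]/(nabla K Y q - lie K Y q).
have [_ nX] := canon_HM_parallel can sK sX; have [_ nY] := canon_HM_parallel can sK sY.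
have [_ lX] := kH _ sX; have [_ lY] := kH _ sY.
have [_ HX] := sX; have [_ HY] := sY.
rewrite hinner_subl// hinner_subr//.
have := nabla_metric sK sX sY q; rewrite (Killing_metric kK sX sY).
lra.
Qed.

(* The Lie derivative of the connection along a Killing field. It is symmetric
   because the torsion of horizontal fields is vertical, and skew because the
   metric is preserved; hence it vanishes, as in the uniqueness of the
   Levi-Civita connection. *)
Definition lie_nabla K X Y := lie K (nabla X Y) - nabla (lie K X) Y - nabla X (lie K Y).

Lemma lie_nabla_horizontal K X Y : H_Killing S K ->
  is_section (HM S) X -> is_section (HM S) Y -> is_section (HM S) (lie_nabla K X Y).
Proof.
move=> [sK kH _ _] sX sY; apply: sectionB; first apply: sectionB.
- by apply: kH; exact: (canon_HM_parallel can sX.1).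
- by apply: (canon_HM_parallel can) => //; have [] := kH _ sX.
- by apply: (canon_HM_parallel can sX.1); exact: kH.
Qed.

(** By the Jacobi identity, the alternation is the Lie derivative [V] of the torsion along [K]. It
    is vertical because [K] preserves [VM], and also horizontal, hence zero. *)
Lemma lie_nabla_sym K X Y : H_Killing S K ->
  is_section (HM S) X -> is_section (HM S) Y -> lie_nabla K X Y = lie_nabla K Y X.
Proof.
move=> kK sX sY; have [sK kH kV _] := kK; apply/funext => q.
have tor A B : is_section (HM S) A -> is_section (HM S) B ->
    is_section (VM S) (torsion nabla A B).
  move=> sA sB; split; last exact: (canon_torHH can).
  apply: smooth_vfB; last exact: smooth_vf_lie sA.1 sB.1.
  by apply: smooth_vfB; apply: nabla_smooth; [exact: sA.1|exact: sB.1|exact: sB.1|exact: sA.1].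
have [sX0 _] := sX; have [sY0 _] := sY.
have sKX := kH _ sX; have sKY := kH _ sY; have [sKX0 _] := sKX; have [sKY0 _] := sKY.
have [sT _] := tor _ _ sX sY.
pose V := lie K (torsion nabla X Y) - torsion nabla (lie K X) Y - torsion nabla X (lie K Y).
have VV : VM S q (V q).
  have [_ H] := sectionB (sectionB (kV _ (tor _ _ sX sY)) (tor _ _ sKX sY)) (tor _ _ sX sKY).
  exact: H.
have HH : HM S q (lie_nabla K X Y q - lie_nabla K Y X q).
  have [_ H] := sectionB (lie_nabla_horizontal kK sX sY) (lie_nabla_horizontal kK sY sX).
  exact: H.
have E : lie_nabla K X Y q - lie_nabla K Y X q = V q.
  have nXY := nabla_smooth sX0 sY0; have nYX := nabla_smooth sY0 sX0.
  have l1 : lie K (torsion nabla X Y) =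
      lie K (nabla X Y) - lie K (nabla Y X) - (lie (lie K X) Y + lie X (lie K Y)).
    rewrite /torsion lieB//; [|exact: smooth_vfB|exact: smooth_vf_lie].
    by rewrite lieB// jacobi.
  apply/funext => f.
  rewrite -[V q f]/(lie K (torsion nabla X Y) q f - torsion nabla (lie K X) Y q f
    - torsion nabla X (lie K Y) q f) l1.
  rewrite -[(lie_nabla K X Y q - lie_nabla K Y X q) f]/(
    (lie K (nabla X Y) q f - nabla (lie K X) Y q f - nabla X (lie K Y) q f) -
    (lie K (nabla Y X) q f - nabla (lie K Y) X q f - nabla Y (lie K X) q f)).
  rewrite -[torsion nabla (lie K X) Y q f]/(nabla (lie K X) Y q f - nabla Y (lie K X) q f
    - lie (lie K X) Y q f).
  rewrite -[torsion nabla X (lie K Y) q f]/(nabla X (lie K Y) q f - nabla (lie K Y) X q f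
    - lie X (lie K Y) q f).
  rewrite -[X in _ = X - _ - _]/(lie K (nabla X Y) q f - lie K (nabla Y X) q f
     - (lie (lie K X) Y q f + lie X (lie K Y) q f)).
  ring.
have : lie_nabla K X Y q - lie_nabla K Y X q = 0.
  by apply: (@HV_eq0 _ _ _ S q) => //; rewrite E.
by move/eqP; rewrite subr_eq0 => /eqP.
Qed.

(** Differentiate the inner product of [Y] and [Z] along [lie K X] in two ways: by metric
    compatibility, and as the commutator of the derivations [K] and [X]. *)
Lemma lie_nabla_skew q K X Y Z : H_Killing S K ->
  is_section (HM S) X -> is_section (HM S) Y -> is_section (HM S) Z ->
  hinner S q (lie_nabla K X Y q) (Z q) = - hinner S q (lie_nabla K X Z q) (Y q).
Proof.
move=> kK sX sY sZ; have [sK kH kV _] := kK.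
have [sX0 _] := sX.
have nab A B : is_section (HM S) A -> is_section (HM S) B -> is_section (HM S) (nabla A B).
  by move=> [sA _]; exact: (canon_HM_parallel can).
have sKX := kH _ sX; have sKY := kH _ sY; have sKZ := kH _ sZ.
have sm A B : is_section (HM S) A -> is_section (HM S) B -> smooth (vf_inner (hinner S) A B).
  exact: (inner_smooth hinnerS).
have XE : vf_app X (vf_inner (hinner S) Y Z) =
    fun y => vf_inner (hinner S) (nabla X Y) Z y + vf_inner (hinner S) Y (nabla X Z) y.
  by apply/funext => y; exact: nabla_metric.
have KE : vf_app K (vf_inner (hinner S) Y Z) =
    fun y => vf_inner (hinner S) (lie K Y) Z y + vf_inner (hinner S) Y (lie K Z) y.
  by apply/funext => y; exact: Killing_metric.
have := nabla_metric sKX.1 sY sZ q.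
rewrite -[lie K X q _]/(K q (vf_app X (vf_inner (hinner S) Y Z)) -
  X q (vf_app K (vf_inner (hinner S) Y Z))) XE KE.
rewrite (tangent_add (smooth_vf_tangent q sK)); [|by apply: sm => //; exact: nab..].
rewrite (tangent_add (smooth_vf_tangent q sX0)); [|by apply: sm..].
rewrite !(Killing_metric kK) ?nabla_metric//; try exact: nab.
have Hs A : is_section (HM S) A -> HM S q (A q) by move=> [].
have HX := Hs _ sX; have HY := Hs _ sY; have HZ := Hs _ sZ.
have TE A B : lie_nabla K A B q = lie K (nabla A B) q - nabla (lie K A) B q - nabla A (lie K B) q.
  by [].
have h1 := Hs _ (kH _ (nab _ _ sX sY)); have h2 := Hs _ (kH _ (nab _ _ sX sZ)).
have h3 := Hs _ (nab _ _ sKX sY); have h4 := Hs _ (nab _ _ sKX sZ).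
have h5 := Hs _ (nab _ _ sX sKY); have h6 := Hs _ (nab _ _ sX sKZ).
have HT a b d e : HM S q a -> HM S q b -> HM S q d -> HM S q e ->
    hinner S q (a - b - d) e = hinner S q a e - hinner S q b e - hinner S q d e.
  by move=> Ha Hb Hd He; rewrite (hinner_subl He (fiberB Ha Hb) Hd) (hinner_subl He Ha Hb).
rewrite !TE (HT _ _ _ _ h1 h3 h5 HZ) (HT _ _ _ _ h2 h4 h6 HY).
rewrite (inner_sym hinnerS HY h6) (inner_sym hinnerS HY h2) (inner_sym hinnerS HY h4).
lra.
Qed.

Lemma lie_nabla0 K X Y : H_Killing S K ->
  is_section (HM S) X -> is_section (HM S) Y -> lie_nabla K X Y = 0.
Proof.
move=> kK sX sY; apply/funext => q.
pose t A B C := hinner S q (lie_nabla K A B q) (C q).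
have tsym A B C : is_section (HM S) A -> is_section (HM S) B -> t A B C = t B A C.
  by move=> sA sB; rewrite /t lie_nabla_sym.
have tskew A B C : is_section (HM S) A -> is_section (HM S) B -> is_section (HM S) C ->
    t A B C = - t A C B.
  by move=> sA sB sC; exact: lie_nabla_skew.
have sT := lie_nabla_horizontal kK sX sY.
set T := lie_nabla K X Y in sT *.
have t0 : t X Y T = 0.
  (* Exchanging the first two and the last two arguments alternately, three times each, returns to
     [t X Y T] with three sign changes. *)
  have : t X Y T = - t X Y T; last lra.
  rewrite {1}(tsym X Y)// (tskew Y X)// (tsym Y T)// (tskew T Y)// opprK.
  by rewrite (tsym T X)// (tskew X T)//.
apply: contrapT => /eqP Tq; have := inner_pos hinnerS (sT.2 q) Tq.
by rewrite -/(t X Y T) t0 ltxx.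
Qed.

End CanonicalConnection.

(** * Unique continuation *)

Section Ideals.
Context {R : realType} {n : nat} {M : manifold R n}.
Variables (q : M) (I : finType) (s : I -> M -> R).
Hypothesis ss : forall i, smooth (s i).
Implicit Types (f h : M -> R) (X Y A : vfield M).

(* The ideal generated by the germs at [q] of the functions [s i]. *)
Definition ideal f := exists2 a : I -> M -> R, (forall i, smooth (a i)) &
  \forall y \near q, f y = \sum_i a i y * s i y.

Lemma ideal_near f h : (\forall y \near q, f y = h y) -> ideal f -> ideal h.
Proof.
by move=> fh [a sa fE]; exists a => //; apply: filterS2 fh fE => y <-.
Qed.

Lemma ideal0 : ideal (cst 0).
Proof.
exists (fun _ => cst 0) => [i|]; first exact: smooth_cst.
by apply: nearW => y; rewrite big1// => i _; rewrite mul0r.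
Qed.

Lemma idealD f h : ideal f -> ideal h -> ideal (fun y => f y + h y).
Proof.
move=> [a sa fE] [b sb hE]; exists (fun i y => a i y + b i y).
  by move=> i; exact: smoothD.
apply: filterS2 fE hE => y -> ->; rewrite -big_split /=.
by apply: eq_bigr => i _; rewrite mulrDl.
Qed.

Lemma idealM f h : smooth h -> ideal f -> ideal (fun y => h y * f y).
Proof.
move=> sh [a sa fE]; exists (fun i y => h y * a i y).
  by move=> i; exact: smoothM.
apply: filterS fE => y ->; rewrite mulr_sumr.
by apply: eq_bigr => i _; rewrite mulrA.
Qed.

Lemma idealB f h : ideal f -> ideal h -> ideal (fun y => f y - h y).
Proof.
move=> If Ih; apply: ideal_near (idealD If (idealM (smooth_cst (-1)) Ih)).
by apply: nearW => y; rewrite mulN1r.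
Qed.

Lemma ideal_sum (J : finType) (F : J -> M -> R) :
  (forall j, ideal (F j)) -> ideal (fun y => \sum_j F j y).
Proof.
move=> IF; suff : ideal (\sum_j F j).
  by apply: ideal_near; apply: nearW => y; rewrite fct_sumE.
elim/big_ind : _ => //; first exact: ideal0.
by move=> f h; exact: idealD.
Qed.

Lemma ideal_gen i : ideal (s i).
Proof.
exists (fun j => cst (j == i)%:R) => [j|]; first exact: smooth_cst.
apply: nearW => y; rewrite (bigD1 i)//= eqxx mul1r big1 ?addr0// => j /negbTE ->.
by rewrite mul0r.
Qed.

(** By the Leibniz rule, stability of the ideal under a derivation need only be checked on
    generators. *)
Lemma ideal_vf_app X f : smooth_vf X -> (forall i, ideal (vf_app X (s i))) ->
  smooth f -> ideal f -> ideal (vf_app X f).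
Proof.
move=> sX IX sf [a sa fE].
have IH : ideal (fun y => \sum_i (a i y * vf_app X (s i) y + vf_app X (a i) y * s i y)).
  apply: ideal_sum => i; apply: idealD; first exact: idealM.
  by apply: idealM; [exact: smooth_vf_app|exact: ideal_gen].
apply: ideal_near IH.
(* Differentiating at [y] uses the expansion of [f] on a neighbourhood of [y]. *)
have : \forall y \near q, \forall z \near y, f z = \sum_i a i z * s i z.
  exact: nbhs_interior.
apply: filterS => y fE'; have tX := smooth_vf_tangent y sX.
have sas i : smooth (fun z => a i z * s i z) by exact: smoothM.
rewrite [RHS](tangent_near tX sf (smooth_sum sas) fE') (tangent_bigsum tX sas).
by apply: eq_bigr => i _; rewrite (tangent_mul tX (sa i) (ss i)) [X in _ + X]mulrC.
Qed.

Lemma lie_hull_ideal (E : set (vfield M)) :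
  (forall X, E X -> smooth_vf X /\ forall i, ideal (vf_app X (s i))) ->
  forall X, lie_hull E X -> smooth_vf X /\ forall i, ideal (vf_app X (s i)).
Proof.
move=> EP X; elim=> {X} [X /EP//|k X Y _ [sX IX] _ [sY IY]|X Y _ [sX IX] _ [sY IY]].
- split; first by apply: smooth_vfD => //; exact: smooth_vfZ.
  move=> i; exact: (idealD (idealM (smooth_cst k) (IX i)) (IY i)).
- split; first exact: smooth_vf_lie.
  move=> i; apply: (idealB (f := vf_app X (vf_app Y (s i))) (h := vf_app Y (vf_app X (s i)))).
    by apply: ideal_vf_app => //; exact: smooth_vf_app.
  by apply: ideal_vf_app => //; exact: smooth_vf_app.
Qed.

(* The vector fields [X] given by the hypothesis form a frame around [q], so that
   all partial derivatives of the [s i] are combinations of the [s i]. *)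
Lemma local_vanishing : (forall i, s i q = 0) ->
  (forall v, tangent q v -> exists X,
    [/\ smooth_vf X, X q = v & forall i, ideal (vf_app X (s i))]) ->
  \forall y \near q, forall i, s i y = 0.
Proof.
move=> s0 HX; have [c [x [D [[ac cq] sx sD nD]]]] := local_coordinates q.
have /choice[X XP] : forall l, exists X,
    [/\ smooth_vf X, X q = D l q & forall i, ideal (vf_app X (s i))].
  by move=> l; apply: HX; exact: smooth_vf_tangent.
have sX l : smooth_vf (X l) by have [] := XP l.
(* [P] expresses the fields [X l] in the coordinate fields. It is the identity at [q], so its
   inverse near [q] writes each [D l] as a combination of the [X k]. *)
pose P y := \matrix_(l < n, i < n) X l y (x i).
have sP l i : smooth (fun y => P y l i).
  rewrite (_ : (fun y => _) = vf_app (X l) (x i)); first exact: smooth_vf_app.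
  by apply/funext => y; rewrite mxE.
have Pq : P q \in unitmx.
  rewrite (_ : P q = 1%:M) ?unitmx1//; apply/matrixP => l i; rewrite !mxE.
  have [_ -> _] := XP l; have [_ _ -> _] := nbhs_singleton nD; by [].
have [B sB nB] := smooth_invmx sP Pq.
have ID (lj : 'I_n * I) : ideal (vf_app (D lj.1) (s lj.2)).
  case: lj => l j /=.
  have H : ideal (fun y => \sum_k B y l k * vf_app (X k) (s j) y).
    by apply: ideal_sum => k; apply: idealM => //; have [] := XP k.
  apply: ideal_near H; apply: filterS2 nB nD => y PB [_ _ _ yE].
  have {}PB : B y *m P y = 1%:M by exact: mulmx1C.
  under eq_bigr do rewrite /vf_app (yE _ (smooth_vf_tangent y (sX _))) tvec_sumE mulr_sumr.
  rewrite exchange_big /= (bigD1 l)//= [X in _ + X]big1 ?addr0.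
    transitivity ((B y *m P y) l l * D l y (s j)).
      rewrite [in RHS]mxE mulr_suml; apply: eq_bigr => k _.
      by rewrite tvec_scaleE mulrA [P y _ _]mxE.
    by rewrite PB mxE eqxx mul1r.
  move=> i il; transitivity ((B y *m P y) l i * D i y (s j)).
    rewrite [in RHS]mxE mulr_suml; apply: eq_bigr => k _.
    by rewrite tvec_scaleE mulrA [P y _ _]mxE.
  by rewrite PB mxE eq_sym (negbTE il) mul0r.
have /choice[a aP] : forall lj : 'I_n * I, exists a : I -> M -> R, (forall i, smooth (a i)) /\
    \forall y \near q, vf_app (D lj.1) (s lj.2) y = \sum_i a i y * s i y.
  by move=> lj; have [a sa aE] := ID lj; exists a.
(* By continuity, near [q] each coefficient is within 1 of its value at [q]; summing those values
   gives one bound for all. *)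
pose C := 1 + \sum_(t : ('I_n * I) * I) `|a t.1 t.2 q|.
have nC : \forall y \near q, forall t : ('I_n * I) * I, `|a t.1 t.2 y| <= C.
  have := @filter_forall _ (('I_n * I) * I)%type (fun t y => `|a t.1 t.2 y| <= C) (nbhs q) _.
  apply => t; have [sa _] := aP t.1.
  have /cvgrPdist_le/(_ 1 ltr01) := @smooth_continuous _ _ _ _ (sa t.2) q.
  apply: filterS => y; rewrite distrC => H.
  rewrite -[a t.1 t.2 y](subrK (a t.1 t.2 q)).
  apply: le_trans (ler_normD _ _) _; apply: lerD => //.
  by rewrite (bigD1 t)//= lerDl sumr_ge0.
have na : \forall y \near q, forall lj : 'I_n * I,
    vf_app (D lj.1) (s lj.2) y = \sum_i a lj i y * s i y.
  have := @filter_forall _ ('I_n * I)%type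
    (fun lj y => vf_app (D lj.1) (s lj.2) y = \sum_i a lj i y * s i y) (nbhs q) _.
  by apply => lj; have [] := aP lj.
pose good y := [/\ cdom c y, forall l, D l y = cvec c 'e_l y,
  forall t : ('I_n * I) * I, `|a t.1 t.2 y| <= C &
  forall lj : 'I_n * I, vf_app (D lj.1) (s lj.2) y = \sum_i a lj i y * s i y].
have : \forall z \near cmap c q, exists2 y, good y & cmap c y = z.
  apply: near_chart => //; apply: filterS3 nD nC na => y [cy Dy _ _] yC ya.
  by exists y.
move=> /nbhs_ballP[d /= d0 dP].
have {}dP z : `|z - cmap c q| < d -> exists2 y, good y & cmap c y = z.
  by move=> zd; apply: dP; rewrite -ball_normE /ball_ /= distrC.
have gr := @gronwall R n I (fun j => s j \o cinv c) (cmap c q) d C.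
have {}gr j z : `|z - cmap c q| < d -> (s j \o cinv c) z = 0.
  move: j z; apply: gr.
  - by move=> j; rewrite /= cmapK.
  - by move=> j z /dP[y [cy _ _ _] <-]; exact: smooth_chart_differentiable.
  - move=> j l z /dP[y [cy Dy yC ya] <-].
    have -> : 'D_'e_l (s j \o cinv c) (cmap c y) = \sum_i a (l, j) i y * s i y.
      by rewrite -(ya (l, j)) /vf_app /= Dy /cvec asboolT.
    apply: le_trans (ler_norm_sum _ _ _) _; rewrite mulr_sumr; apply: ler_sum => i _.
    rewrite /= cmapK// normrM ler_wpM2r//; exact: (yC ((l, j), i)).
have nb : \forall y \near q, `|cmap c y - cmap c q| < d.
  have /cvgrPdist_lt/(_ d d0) := cmap_continuous cq.
  by apply: filterS => y; rewrite distrC.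
apply: filterS2 nb (near_cdom cq) => y yd cy i.
by have := gr i _ yd; rewrite /= cmapK.
Qed.

End Ideals.

(** * Prolongation of Killing fields, and injectivity *)

Section Injectivity.
Context {R : realType} {n : nat} {M : manifold R n} (S : sRC M).
Context (g : M -> tvec M -> tvec M -> R) (nabla : vfield M -> vfield M -> vfield M).
Hypothesis ext : metric_extension S g.
Hypothesis can : canonical_connection S g nabla.
Implicit Types (f : M -> R) (X Y Z A : vfield M).

Section Prolongation.
Variables (K : vfield M) (q : M).
Variables (x : 'I_n -> M -> R) (D : 'I_n -> vfield M).
Hypothesis kK : H_Killing S K.
Hypothesis sx : forall i, smooth (x i).
Hypothesis sD : forall i, smooth_vf (D i).
Hypothesis nD : \forall y \near q, forall v, tangent y v -> v = \sum_i v (x i) *: D i y.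

Let sK : smooth_vf K := H_Killing_smooth kK.
Let HD i : is_section (HM S) (hproj S (D i)) := section_hproj S (sD i).
Let B Y := BK S nabla K Y.

(* Near [q], these functions generate the ideal of all [K f] and
   [BK S nabla K Y f] with [Y] horizontal. *)
Definition jet (t : 'I_n + 'I_n * 'I_n) : M -> R :=
  match t with
  | inl i => vf_app K (x i)
  | inr (j, i) => vf_app (B (hproj S (D j))) (x i)
  end.

Lemma smooth_B Y : smooth_vf Y -> is_section (HM S) (B Y).
Proof. by move=> sY; exact: (BK_smooth can). Qed.

Lemma smooth_jet t : smooth (jet t).
Proof.
case: t => [i|[j i]] /=; apply: smooth_vf_app => //.
by have [] := smooth_B (HD j).1.
Qed.

Let I := ideal q jet.
(** These are the fields that vanish modulo [I]; the computations below are congruences modulo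
    them. *)
Definition negligible A := smooth_vf A /\ forall f, smooth f -> I (vf_app A f).

Lemma negligible_smooth A : negligible A -> smooth_vf A.
Proof. by case. Qed.

Lemma negligible_coord A : smooth_vf A -> (forall i, I (vf_app A (x i))) -> negligible A.
Proof.
move=> sA IA; split=> // f sf.
have H : I (fun y => \sum_i vf_app (D i) f y * vf_app A (x i) y).
  by apply: ideal_sum => i; apply: idealM; [exact: smooth_vf_app|exact: IA].
apply: ideal_near H; apply: filterS nD => y yE.
rewrite [RHS]/vf_app (yE _ (smooth_vf_tangent y sA)) tvec_sumE.
by apply: eq_bigr => i _; rewrite tvec_scaleE mulrC.
Qed.

(** Near [q], [F A] is the combination of the [F (D i)] with coefficients [A (x i)], which lie in
    [I]. *)
Lemma negligible_tensor (F : vfield M -> vfield M) A :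
  (forall X, smooth_vf X -> smooth_vf (F X)) ->
  (forall y, Cinf_linear y (fun X => F X y)) -> negligible A -> negligible (F A).
Proof.
move=> sF FL [sA IA]; split=> [|f sf]; first exact: sF.
have H : I (fun y => \sum_i vf_app (F (D i)) f y * vf_app A (x i) y).
  apply: ideal_sum => i; apply: idealM; last exact: IA.
  by apply: smooth_vf_app => //; exact: sF.
apply: ideal_near H; apply: filterS nD => y yE.
rewrite [RHS]/vf_app (tensor_coord (FL y) sA sD yE) tvec_sumE.
by apply: eq_bigr => i _; rewrite tvec_scaleE mulrC.
Qed.

Lemma negligibleB A A' : negligible A -> negligible A' -> negligible (A - A').
Proof.
move=> [sA IA] [sA' IA']; split=> [|f sf]; first exact: smooth_vfB.
exact: (idealB (IA f sf) (IA' f sf)).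
Qed.

Lemma negligible_nabla A Y : negligible A -> smooth_vf Y -> negligible (nabla A Y).
Proof.
move=> nA sY; apply: (negligible_tensor (F := nabla^~ Y)) nA.
  by move=> X sX; exact: (nabla_smooth can).
by move=> y; exact: (nabla_Cinf_linear can).
Qed.

Lemma negligible_ndiff X A : smooth_vf X -> negligible A -> negligible (ndiff nabla X A).
Proof.
move=> sX; apply: negligible_tensor; first by move=> Y sY; exact: (ndiff_smooth can).
by move=> y; exact: (ndiff_Cinf_linear can).
Qed.

Lemma negligible_K : negligible K.
Proof. by apply: negligible_coord => // i; exact: (ideal_gen _ jet (inl i)). Qed.

(** The coordinate fields are not horizontal. Precomposing [B] with the projection gives a tensor on
    all fields, which can be expanded in them without choosing a frame of [HM]. *)
Lemma B_coord y Y : (forall v, tangent y v -> v = \sum_i v (x i) *: D i y) ->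
  is_section (HM S) Y -> B Y y = \sum_j Y y (x j) *: B (hproj S (D j)) y.
Proof.
move=> yE [sY HY]; have FL : Cinf_linear y (fun A => B (hproj S A) y).
  move=> f A A' sf sA sA'.
  have -> : hproj S (fscale f A + A') = fscale f (hproj S A) + hproj S A'.
    by apply/funext => z; exact: hpr_linear (smooth_vf_tangent z sA) (smooth_vf_tangent z sA').
  by apply: (BK_Cinf_linear can) => //; exact: smooth_hproj.
rewrite -(tensor_coord FL sY sD yE); congr (B _ y).
by apply/funext => z; rewrite -[RHS]/(hpr S z (Y z)) hpr_H.
Qed.

Lemma negligible_B Y : is_section (HM S) Y -> negligible (B Y).
Proof.
move=> sY; apply: negligible_coord; first by have [] := smooth_B sY.1.
move=> i; have H : I (fun y => \sum_j vf_app Y (x j) y * jet (inr (j, i)) y).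
  apply: ideal_sum => j; apply: idealM; last exact: (ideal_gen _ jet (inr (j, i))).
  exact: smooth_vf_app sY.1 _.
apply: ideal_near H; apply: filterS nD => y yE.
rewrite [RHS]/vf_app (B_coord yE sY) tvec_sumE.
by apply: eq_bigr => j _; rewrite tvec_scaleE.
Qed.

Lemma lie_ndiff X A : lie X A = nabla X A - ndiff nabla X A.
Proof. by rewrite /ndiff opprB addrC subrK. Qed.

Lemma negligible_lieK X : is_section (HM S) X -> negligible (lie K X).
Proof.
move=> sX; rewrite lie_ndiff; apply: negligibleB.
  by apply: negligible_nabla; [exact: negligible_K|exact: sX.1].
by rewrite -(BK_horizontal can kK sX); exact: negligible_B.
Qed.

(** [X (K f) = K (X f) - [K, X] f], and both [K] and [[K, X]] are negligible. *)
Lemma ideal_XK X f : is_section (HM S) X -> smooth f -> I (vf_app X (vf_app K f)).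
Proof.
move=> sX sf; have [sX0 _] := sX.
apply: (@ideal_near _ _ _ q _ jet (fun y => vf_app K (vf_app X f) y - vf_app (lie K X) f y)).
  by apply: nearW => y; rewrite /vf_app /lie subKr.
apply: idealB; first by apply: negligible_K.2; exact: smooth_vf_app.
exact: (negligible_lieK sX).2.
Qed.

(** Expand [nabla K Y] in the [nabla (D i) Y], with coefficients [K (x i)]. After the Leibniz rule,
    [ideal_XK] takes care of the terms where [X] hits a coefficient. *)
Lemma ideal_X_nablaK X Y f : is_section (HM S) X -> smooth_vf Y -> smooth f ->
  I (vf_app X (vf_app (nabla K Y) f)).
Proof.
move=> [sX HX] sY sf; have sN i : smooth_vf (nabla (D i) Y) by exact: (nabla_smooth can).
have sKx i : smooth (vf_app K (x i)) by exact: smooth_vf_app.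
have sNf i : smooth (vf_app (nabla (D i) Y) f) by exact: smooth_vf_app.
have sP i : smooth (fun y => vf_app K (x i) y * vf_app (nabla (D i) Y) f y).
  exact: smoothM.
have H : I (fun y => \sum_i (vf_app X (vf_app (nabla (D i) Y) f) y * vf_app K (x i) y +
    vf_app (nabla (D i) Y) f y * vf_app X (vf_app K (x i)) y)).
  apply: ideal_sum => i; apply: idealD; apply: idealM.
  - exact: smooth_vf_app.
  - exact: (ideal_gen _ jet (inl i)).
  - exact: sNf.
  - exact: ideal_XK.
apply: ideal_near H.
have E : \forall y \near q, vf_app (nabla K Y) f y =
    \sum_i vf_app K (x i) y * vf_app (nabla (D i) Y) f y.
  apply: filterS nD => y yE.
  rewrite [LHS]/vf_app (tensor_coord (nabla_Cinf_linear can y sY) sK sD yE) tvec_sumE.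
  by apply: eq_bigr => i _; rewrite tvec_scaleE.
have : \forall y \near q, \forall z \near y, vf_app (nabla K Y) f z =
    \sum_i vf_app K (x i) z * vf_app (nabla (D i) Y) f z.
  exact: nbhs_interior.
apply: filterS => y E'; have tX := smooth_vf_tangent y sX.
have sKY : smooth (vf_app (nabla K Y) f).
  by apply: smooth_vf_app => //; exact: (nabla_smooth can).
rewrite [RHS](tangent_near tX sKY (smooth_sum sP) E') (tangent_bigsum tX sP).
apply: eq_bigr => i _; rewrite (tangent_mul tX (sKx i) (sNf i)).
by rewrite /vf_app; ring.
Qed.

(** For negligible [A], covariant differentiation agrees modulo [I] with differentiating [A f]: the
    difference is [ndiff X A f - A (X f)], and [ndiff X] is a tensor. *)
Lemma ideal_nabla X A f : smooth_vf X -> smooth f -> negligible A ->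
  I (vf_app X (vf_app A f)) <-> I (vf_app (nabla X A) f).
Proof.
move=> sX sf nA; have [sA IA] := nA.
have I1 : I (fun y => vf_app (ndiff nabla X A) f y - vf_app A (vf_app X f) y).
  apply: idealB; first exact: (negligible_ndiff sX nA).2.
  by apply: IA; exact: smooth_vf_app.
have E y : vf_app (nabla X A) f y - vf_app X (vf_app A f) y =
    vf_app (ndiff nabla X A) f y - vf_app A (vf_app X f) y.
  rewrite /vf_app -[ndiff nabla X A y f]/(nabla X A y f -
    (X y (vf_app A f) - A y (vf_app X f))) /vf_app; ring.
split=> H.
- apply: ideal_near (idealD I1 H); apply: nearW => y.
  by rewrite -E subrK.
- apply: ideal_near (idealB H I1); apply: nearW => y.
  by rewrite -E subKr.
Qed.

(* [nabla X (B Y)] is computed from [lie_nabla K X Y = 0]: modulo negligible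
   fields this is the identity [nabla_X B = R(X, K)]. *)
Lemma ideal_XB X Y f : is_section (HM S) X -> is_section (HM S) Y -> smooth f ->
  I (vf_app X (vf_app (B Y) f)).
Proof.
move=> sX sY sf; have [sX0 _] := sX; have [sY0 _] := sY.
apply/(ideal_nabla sX0 sf (negligible_B sY)).
have [_ kH _ _] := kK.
have sXY := canon_HM_parallel can sX0 sY; have [sXY0 _] := sXY.
have sKY := kH _ sY; have [sKY0 _] := sKY.
have nKY := negligible_nabla negligible_K sY0.
(* The parenthesis is [nabla X (lie K Y)]: by [lie_nabla0] it equals
   [lie K (nabla X Y) - nabla (lie K X) Y], and the bracket with the horizontal field [nabla X Y] is
   again rewritten through [B]. *)
have E : nabla X (B Y) = nabla X (nabla K Y) -
    (nabla K (nabla X Y) - B (nabla X Y) - nabla (lie K X) Y).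
  rewrite /B (BK_horizontal can kK sY) (BK_horizontal can kK sXY) -lie_ndiff.
  rewrite /ndiff (nabla_Br can)//; last exact: negligible_smooth nKY.
  congr (_ - _); have := lie_nabla0 ext can kK sX sY.
  by rewrite /lie_nabla => /eqP; rewrite subr_eq0 => /eqP ->.
(* Only the first term differentiates a negligible field; the others are negligible one by one. *)
rewrite E; apply: (idealB (f := vf_app (nabla X (nabla K Y)) f)).
  by apply/(ideal_nabla sX0 sf nKY); exact: ideal_X_nablaK.
have [_ H] := negligibleB (negligibleB (negligible_nabla negligible_K sXY0)
  (negligible_B sXY)) (negligible_nabla (negligible_lieK sX) sY0).
exact: H.
Qed.

Lemma ideal_jet X t : is_section (HM S) X -> I (vf_app X (jet t)).
Proof.
move=> sX; case: t => [i|[j i]] /=; first exact: ideal_XK.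
exact: ideal_XB.
Qed.

(** The hypotheses make all generators vanish at [q]. Once they vanish nearby, they determine [K]
    and, through [B_coord], [B] there. *)
Lemma jet_vanishing : K q = 0 -> (forall Y, is_section (HM S) Y -> B Y q = 0) ->
  \forall y \near q, K y = 0 /\ forall Y, is_section (HM S) Y -> B Y y = 0.
Proof.
move=> Kq Bq.
have : \forall y \near q, forall t, jet t y = 0.
  apply: (local_vanishing smooth_jet).
    by case=> [i|[j i]] /=; rewrite /vf_app ?Kq ?Bq.
  move=> v tv; have [X LX Xq] := HM_bracket_generating S tv.
  have [sX IX] := lie_hull_ideal smooth_jet (fun X (sX : is_section (HM S) X) =>
    conj sX.1 (fun t => ideal_jet t sX)) LX.
  by exists X.
apply: filterS2 nD => y yE jy; split.
  rewrite (yE _ (smooth_vf_tangent y sK)) big1// => i _.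
  by rewrite -[K y (x i)]/(jet (inl i) y) jy scale0r.
move=> Y sY; rewrite (B_coord yE sY) big1// => j _.
rewrite (yE _ (smooth_vf_tangent y (smooth_B (HD j).1).1)) big1 ?scaler0// => i _.
by rewrite -[X in X *: _]/(jet (inr (j, i)) y) jy scale0r.
Qed.

End Prolongation.

Lemma Killing_eq0 K p : connected [set: M] -> H_Killing S K -> K p = 0 ->
  (forall Y, is_section (HM S) Y -> BK S nabla K Y p = 0) -> K = 0.
Proof.
move=> conn kK Kp Bp; have sK := H_Killing_smooth kK.
pose Z := [set q | K q = 0 /\ forall Y, is_section (HM S) Y -> BK S nabla K Y q = 0].
(* The zero set of a field is the intersection of the zero sets of the continuous functions [A f],
   for [f] smooth. *)
have zeros (A : vfield M) : smooth_vf A -> closed [set q | A q = 0].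
  move=> sA; have -> : [set q | A q = 0] =
      \bigcap_(f in [set f | smooth f]) (vf_app A f @^-1` [set 0]).
    apply/seteqP; split=> [q Aq f _|q Aq] /=; first by rewrite /vf_app Aq.
    apply: (tangent_ext (smooth_vf_tangent q sA) (tangent0 q)) => f sf.
    exact: Aq.
  apply: closed_bigI => f sf; apply: closed_comp; last exact: closed_eq.
  by move=> y _; apply: smooth_continuous; exact: smooth_vf_app.
have cZ : closed Z.
  have -> : Z = [set q | K q = 0] `&`
      \bigcap_(Y in is_section (HM S)) [set q | BK S nabla K Y q = 0].
    by apply/seteqP; split=> q [].
  apply: closedI; first exact: zeros.
  apply: closed_bigI => Y sY; apply: zeros.
  by have [] := BK_smooth can sK sY.1.
have oZ : open Z.
  rewrite openE => q [Kq Bq]; rewrite /interior.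
  have [c [x [D [[ac cq] sx sD nD]]]] := local_coordinates q.
  apply: (jet_vanishing kK sx sD) => //.
  by apply: filterS nD => y [].
have ZT : Z = setT.
  apply: conn; first by exists p.
    by exists Z => //; rewrite setTI.
  by exists Z => //; rewrite setTI.
apply/funext => q; have : Z q by rewrite ZT.
by case.
Qed.

Lemma H_Killing_linear (k : R) K L : H_Killing S K -> H_Killing S L ->
  H_Killing S (k *: K + L).
Proof.
move=> kK kL; have [sK hK vK _] := kK; have [sL hL vL _] := kL.
have lE X : smooth_vf X -> lie (k *: K + L) X = k *: lie K X + lie L X.
  by move=> sX; exact: lie_linearl.
split.
- by apply: smooth_vfD => //; exact: smooth_vfZ.
- move=> X sX; rewrite lE; last exact: sX.1.
  by apply: section_linear; [exact: hK|exact: hL].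
- move=> X sX; rewrite lE; last exact: sX.1.
  by apply: section_linear; [exact: vK|exact: vL].
- move=> X Y sX sY; apply/funext => q.
  rewrite -[LHS]/(k * K q (vf_inner (hinner S) X Y) + L q (vf_inner (hinner S) X Y)).
  rewrite (Killing_metric kK sX sY) (Killing_metric kL sX sY).
  rewrite !lE; [|exact: sY.1|exact: sX.1].
  rewrite -[RHS]/(hinner S q (k *: lie K X q + lie L X q) (Y q) +
    hinner S q (X q) (k *: lie K Y q + lie L Y q)).
  have [_ HX] := sX; have [_ HY] := sY.
  have [_ KX] := hK _ sX; have [_ KY] := hK _ sY.
  have [_ LX] := hL _ sX; have [_ LY] := hL _ sY.
  have hP := hinnerP S.
  rewrite (inner_linear hP)// [X in _ = _ + X](inner_sym hP)//; last first.
    exact: fiber_linear.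
  rewrite (inner_linear hP)// (inner_sym hP (KY q) (HX q)) (inner_sym hP (LY q) (HX q)).
  ring.
Qed.

Lemma BK_linearK (k : R) K L A : smooth_vf K -> smooth_vf L -> smooth_vf A ->
  BK S nabla (k *: K + L) A = k *: BK S nabla K A + BK S nabla L A.
Proof.
move=> sK sL sA.
have sKL : smooth_vf (k *: K + L) by apply: smooth_vfD => //; exact: smooth_vfZ.
rewrite !(BKE can)//; apply/funext => q.
rewrite -[LHS]/(hpr S q (ndiff nabla (k *: K + L) A q)).
have -> : ndiff nabla (k *: K + L) A = k *: ndiff nabla K A + ndiff nabla L A.
  rewrite /ndiff lie_linearl// -fscale_cst.
  rewrite (conn_linearl (canon_connection can) (smooth_cst k) sK sL sA) fscale_cst.
  by rewrite opprD addrACA (scalerBr k (nabla K A)).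
apply: hpr_linear; apply: smooth_vf_tangent; exact: (ndiff_smooth can).
Qed.

Lemma BK_at_skew K p : H_Killing S K -> skew_end S p (BK_at S nabla K p).
Proof.
move=> kK; have sK := H_Killing_smooth kK; split.
- by move=> v nHv; rewrite /BK_at asboolF.
- move=> v Hv; have [X sX <-] := extend_horizontal Hv.
  rewrite (BK_atE can sK sX.1 (sX.2 p)).
  by have [_] := BK_smooth can sK sX.1.
- move=> k u v Hu Hv.
  have [X sX Xu] := extend_horizontal Hu; have [Y sY Yv] := extend_horizontal Hv.
  have sXY := section_linear k sX sY.
  rewrite -Xu -Yv -[k *: X p + Y p]/((k *: X + Y) p).
  rewrite (BK_atE can sK sXY.1 (sXY.2 p)) (BK_atE can sK sX.1 (sX.2 p)).
  rewrite (BK_atE can sK sY.1 (sY.2 p)) -fscale_cst.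
  exact: (BK_Cinf_linear can p sK (smooth_cst k) sX.1 sY.1).
- move=> u v Hu Hv.
  have [X sX <-] := extend_horizontal Hu; have [Y sY <-] := extend_horizontal Hv.
  rewrite (BK_atE can sK sX.1 (sX.2 p)) (BK_atE can sK sY.1 (sY.2 p)).
  exact: (BK_skew ext can).
Qed.

Lemma chi_linear (k : R) K L p : H_Killing S K -> H_Killing S L ->
  chi S nabla p (k *: K + L) = k *: chi S nabla p K + chi S nabla p L.
Proof.
move=> kK kL; have sK := H_Killing_smooth kK; have sL := H_Killing_smooth kL.
congr pair; apply/funext => v.
rewrite -[RHS]/(k *: BK_at S nabla K p v + BK_at S nabla L p v) /BK_at.
case: asboolP => Hv; last by rewrite scaler0 addr0.
have [sE _] := extendP (fiber_tangent Hv).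
by rewrite BK_linearK.
Qed.

End Injectivity.

Theorem theorem3p6 (R : realType) (n : nat) (M : manifold R n) (S : sRC M)
    (g : M -> tvec M -> tvec M -> R)
    (nabla : vfield M -> vfield M -> vfield M) (p : M) :
  connected [set: M] ->
  sr_complete S ->
  metric_extension S g ->
  canonical_connection S g nabla ->
  [/\ (* (B_K)_{|p} is the value at p of the tensor B_K, restricted to H_p M *)
      forall K A, H_Killing S K -> smooth_vf A -> HM S p (A p) ->
        BK_at S nabla K p (A p) = BK S nabla K A p,
      (* chi_p takes its values in T_p M x skew(H_p M) *)
      forall K, H_Killing S K ->
        tangent p (chi S nabla p K).1 /\ skew_end S p (chi S nabla p K).2,
      (* chi_p is linear *)
      forall (a : R) K L, H_Killing S K -> H_Killing S L ->
        H_Killing S (a *: K + L) /\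
        chi S nabla p (a *: K + L) =
          a *: chi S nabla p K + chi S nabla p L &
      (* chi_p is injective *)
      forall K L, H_Killing S K -> H_Killing S L ->
        chi S nabla p K = chi S nabla p L -> K = L].
Proof.
move=> conn _ ext can; split.
- by move=> K A kK sA HA; exact: (BK_atE can (H_Killing_smooth kK)).
- move=> K kK; split; last exact: (BK_at_skew ext can).
  exact: smooth_vf_tangent p (H_Killing_smooth kK).
- move=> a K L kK kL; split; first exact: H_Killing_linear.
  exact: (chi_linear can).
- move=> K L kK kL KL; apply/eqP; rewrite eq_sym -subr_eq0 addrC -scaleN1r; apply/eqP.
  (* The field to be shown zero is [L - K], written in the form covered by the linearity of
     [chi]. *)
  have kD := H_Killing_linear (-1) kK kL.
  have := chi_linear can (-1) p kK kL; rewrite KL [in RHS]scaleN1r [in RHS]addNr => -[D0 B0].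
  apply: (Killing_eq0 ext can (p := p)) => // Y sY.
  rewrite -(BK_atE can (H_Killing_smooth kD) sY.1 (sY.2 p)).
  by rewrite B0.
Qed.
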